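(* Let $I$ be a finite set, $E$ a Polish space with its Borel $\sigma$-field, $\mathcal{X}=E^I$, $\mu$ a probability measure on $\mathcal{X}$, and let $X$ be a random variable with law $\mu$; for $i\in I$ let $X^i$ be obtained from $X$ by resampling the $i$-th coordinate from its conditional distribution given the other coordinates (see context). Let $\mathcal{E}$ be the bilinear form of the Glauber dynamics, $$\mathcal{E}(f,g)=\frac12\sum_{i\in I}\mathbb{E}\,(f(X)-f(X^i))(g(X)-g(X^i)).$$ If the Glauber dynamics satisfies the modified log-Sobolev inequality with constant $\rho_0>0$, i.e. $\rho_0\,\mathrm{Ent}_\mu(f)\le\mathcal{E}(f,\log f)$ for all nonnegative $f\in\mathrm{Dom}(\mathcal{E})$ with $\log f\in\mathrm{Dom}(\mathcal{E})$, then for every $p\in(1,2]$ the Beckner inequality $$\alpha_p\bigl(\mu(f^p)-\mu(f)^p\bigr)\le\frac p2\mathcal{E}(f,f^{p-1})\quad\text{for all nonnegative } f\in\mathrm{Dom}(\mathcal{E})\text{ with }f^{p-1}\in\mathrm{Dom}(\mathcal{E})$$ holds with $\alpha_p\ge\rho_0/6$. Moreover for every (measurable) function $f\colon\mathcal{X}\to\mathbb{R}$ and $r\ge2$, $$\|(f(X)-\mathbb{E}f(X))_+\|_r\le K\sqrt r\,\Bigl\|\Bigl(\sum_{i\in I}\mathbb{E}\bigl((f(X)-f(X^i))_+^2\,\big|\,X\bigr)\Bigr)^{1/2}\Bigr\|_r\le K\sqrt r\,\Bigl\|\Bigl(\sum_{i\in I}(f(X)-f(X^i))_+^2\Bigr)^{1/2}\Bigr\|_r$$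 and $$\|f(X)-\mathbb{E}f(X)\|_r\le K\sqrt r\,\Bigl\|\Bigl(\sum_{i\in I}\mathbb{E}\bigl((f(X)-f(X^i))^2\,\big|\,X\bigr)\Bigr)^{1/2}\Bigr\|_r\le K\sqrt r\,\Bigl\|\Bigl(\sum_{i\in I}(f(X)-f(X^i))^2\Bigr)^{1/2}\Bigr\|_r,$$ where $K=\sqrt{\frac{3\sqrt e}{\rho_0(\sqrt e-1)}}$.
   Context: For $i\in I$, $\mu_i(\cdot|x)$ denotes the (regular) conditional distribution $\mathbb{P}(X_i\in\cdot\,|\,X_{I\setminus\{i\}}=x_{I\setminus\{i\}})$. $X_i'$ is an $E$-valued random variable whose conditional distribution given $X=x$ is $\mu_i(\cdot|x)$ (so $X_i,X_i'$ are conditionally i.i.d. given the remaining coordinates), and $X^i$ is $X$ with $X_i$ replaced by $X_i'$. $\mathrm{Dom}(\mathcal{E})$ is the set of measurable $f\colon\mathcal{X}\to\mathbb{R}$ with $\sum_{i}\mathbb{E}(f(X)-f(X^i))^2<\infty$. $\mu(f)=\int f\,d\mu$; $\mathrm{Ent}_\mu(f)=\mu(f\log f)-\mu(f)\log\mu(f)$; $\|Y\|_r=(\mathbb{E}|Y|^r)^{1/r}$; $t_+=\max(t,0)$. Convention: an estimate $A\le B$ means ''if $B<\infty$, then $A$ is well-defined and the inequality holds''. *)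

(* Defs.v *)
From HB Require Import structures.
From mathcomp Require Import all_boot all_order all_algebra.
From mathcomp Require Import all_classical all_reals all_analysis measurable_realfun.

Set Implicit Arguments.
Unset Strict Implicit.
Unset Printing Implicit Defensive.

Import Order.TTheory GRing.Theory Num.Theory.
Import numFieldNormedType.Exports.

Local Open Scope classical_set_scope.
Local Open Scope ring_scope.

Definition is_metric (R : realType) (E : Type) (d : E -> E -> R) : Prop :=
  [/\ forall x, d x x = 0,
      forall x y, d x y = 0 -> x = y,
      forall x y, d x y = d y x &
      forall x y z, d x z <= d x y + d y z].

Definition metrizes (R : realType) (E : topologicalType) (d : E -> E -> R) : Prop :=
  forall (x : E) (A : set E),
    nbhs x A <-> exists2 e : R, 0 < e & [set y | d x y < e] `<=` A.

Definition complete_metric (R : realType) (E : topologicalType)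
    (d : E -> E -> R) : Prop :=
  forall u : nat -> E,
    (forall e : R, 0 < e -> exists N, forall m n,
       (N <= m)%N -> (N <= n)%N -> d (u m) (u n) < e) ->
    exists l : E, u @ \oo --> l.

Definition polish_space (R : realType) (E : topologicalType) : Prop :=
  (exists2 D : set E, countable D & dense D) /\
  (exists d : E -> E -> R, [/\ is_metric d, metrizes d & complete_metric d]).

Definition borelType (E : ptopologicalType) : measurableType (@open E).-sigma :=
  g_sigma_algebraType (@open E).

(* T^J, with the product sigma-algebra; for J finite and T the Borel space of a
   Polish space this is the Borel sigma-algebra of the product topology. *)
Definition cylinders (J : Type) d (T : measurableType d) : set (set (J -> T)) :=
  \bigcup_(j in [set: J]) preimage_set_system setT (fun x : J -> T => x j) measurable.

Definition power (J : Type) d (T : measurableType d) :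
    measurableType (@cylinders J d T).-sigma :=
  g_sigma_algebraType (@cylinders J d T).

Section Resampling.
Context (R : realType) (I : finType) (dE : measure_display)
  (E : measurableType dE).

Definition others (i : I) : Type := {j : I | j != i}.

Definition restr (i : I) (x : power I E) : power (others i) E :=
  fun j => x (val j).
Arguments restr i x : clear implicits.

Definition resample (i : I) (x : power I E) (y : E) : power I E :=
  fun j => if j == i then y else x j.
Arguments resample i x y : clear implicits.

Definition is_cond_distribution (mu : probability (power I E) R) (i : I)
    (k : R.-pker (power (others i) E) ~> E) : Prop :=
  forall (A : set (power (others i) E)) (B : set E),
    measurable A -> measurable B ->
    mu [set x | A (restr i x) /\ B (x i)] =
    (\int[mu]_(x in restr i @^-1` A) k (restr i x) B)%E.

(* The joint law of the family (X'_i)_i given X is left arbitrary: only the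
   conditional law of each X'_i is prescribed. *)
Definition is_resampled_coordinate (mu : probability (power I E) R) (i : I)
    (k : R.-pker (power (others i) E) ~> E)
    dO (Omega : measurableType dO) (P : probability Omega R)
    (X : Omega -> power I E) (X'i : Omega -> E) : Prop :=
  forall (A : set (power I E)) (B : set E), measurable A -> measurable B ->
    P (X @^-1` A `&` X'i @^-1` B) = (\int[mu]_(x in A) k (restr i x) B)%E.

End Resampling.

Arguments restr {I dE E} i x.
Arguments resample {I dE E} i x y.

(* Y is a version of E(Z | X), for a [0, +oo]-valued random variable Z. *)
Definition is_cond_expectation (R : realType) dO (Omega : measurableType dO)
    (P : probability Omega R) dT (T : measurableType dT) (X : Omega -> T)
    (Z Y : Omega -> \bar R) : Prop :=
  [/\ forall w, (0 <= Y w)%E,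
      measurable_fun setT (Y : g_sigma_algebra_preimageType X -> \bar R) &
      forall A, g_sigma_algebra_preimage X A ->
        (\int[P]_(w in A) Y w = \int[P]_(w in A) Z w)%E].

(* The convention for estimates A <= B, where wd states that A is well defined. *)
Definition estimate (R : realType) (wd : Prop) (A B : \bar R) : Prop :=
  (B < +oo)%E -> wd /\ (A <= B)%E.

Section Glauber.
Context (R : realType) (I : finType) (dE : measure_display)
  (E : measurableType dE) (mu : probability (power I E) R)
  (dO : measure_display) (Omega : measurableType dO) (P : probability Omega R)
  (X : Omega -> power I E) (X' : I -> Omega -> E).

Definition Xi (i : I) (w : Omega) : power I E := resample i (X w) (X' i w).
Arguments Xi i w : clear implicits.

Definition in_Dom (f : power I E -> R) : Prop :=
  measurable_fun [set: power I E] f /\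
  (\sum_(i : I) \int[P]_w ((f (X w) - f (Xi i w)) ^+ 2)%:E < +oo)%E.

Definition glauber_form (f g : power I E -> R) : R :=
  2^-1 * \sum_(i : I)
    \int[P]_w ((f (X w) - f (Xi i w)) * (g (X w) - g (Xi i w))).

Definition entropy (f : power I E -> R) : R :=
  (\int[mu]_x (f x * ln (f x))) -
  (\int[mu]_x f x) * ln (\int[mu]_x f x).

(* As log f in Dom must be a real-valued function, f > 0 everywhere; with
   f >= 0 only, the value ln 0 = 0 of the library would let indicator functions
   in. The integrability clauses say that Ent(f) is well defined. *)
Definition modified_log_sobolev (rho0 : R) : Prop :=
  forall f : power I E -> R, (forall x, 0 < f x) ->
    in_Dom f -> in_Dom (fun x => ln (f x)) ->
    [/\ mu.-integrable setT (EFin \o f),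
        mu.-integrable setT (fun x => (f x * ln (f x))%:E) &
        rho0 * entropy f <= glauber_form f (fun x => ln (f x))].

Definition beckner (p alpha : R) : Prop :=
  forall f : power I E -> R, (forall x, 0 <= f x) ->
    in_Dom f -> in_Dom (fun x => f x `^ (p - 1)) ->
    [/\ mu.-integrable setT (EFin \o f),
        mu.-integrable setT (fun x => (f x `^ p)%:E) &
        alpha * ((\int[mu]_x (f x `^ p)) - (\int[mu]_x f x) `^ p)
        <= p / 2 * glauber_form f (fun x => f x `^ (p - 1))].

End Glauber.

Arguments Xi {I dE E dO Omega} X X' i w.

(* Main.v *)
Require Import Defs.
From HB Require Import structures.
From mathcomp Require Import all_boot all_order all_algebra.
From mathcomp Require Import all_classical all_reals all_analysis measurable_realfun.
From mathcomp Require Import ring lra.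

(* Beckner from modified log-Sobolev.  Apply the latter to f + s, s > 0: its
   entropy is the mu-integral of the Bregman divergence of u ln u between f + s
   and mu(f) + s, and its energy is E(f, ln (f + s)).  Integrating against
   s^(p-2) ds turns, by homogeneity, the entropies into a multiple G of
   mu(f^p) - mu(f)^p and the energies into a multiple F of E(f, f^(p-1)), and
   nonnegativity of the divergence forces F <= 3 G.  The case p = 2 is the
   limit s -> oo.

   Moments.  Put N q = mu(g^q), where g is the truncated (f - mu(f))_+ or
   |f - mu(f)|.  Beckner's inequality with exponent q / (q - 1) for g^(q-1),
   exchangeability of (X, X^i) and Young's inequality bound N q by N (q - 1) and
   the conditional variance term; induction on q in steps of 1 starts from the
   Poincare inequality. *)

Set Implicit Arguments.
Unset Strict Implicit.
Unset Printing Implicit Defensive.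

Import Order.TTheory GRing.Theory Num.Theory.
Import numFieldNormedType.Exports.

Local Open Scope classical_set_scope.
Local Open Scope ring_scope.

(** * Kernels *)

(** Membership in [Dom] controls only the increments of [f], so integrability must come out as a
    conclusion. For [s > 0], [ln (f + s)] is [1/s]-Lipschitz in [f], hence in [Dom], and the
    integrability clauses of the modified log-Sobolev inequality then make [f] integrable. The case
    p = 2 is set apart because the integral of [s^(p-2) * ln (1 + 1/s)], which defines F, diverges
    at infinity for p = 2. The 6 in [rho0 / 6] is 2 times 3: dividing by G leaves [rho0 * (mu(f^p) -
    mu(f)^p) <= 3 E(f, f^(p-1))], and [p / 2 >= 1 / 2]. In the moment part, going from [q - 1] to
    [q] gains [theta = 1 - e^(-1/2)], because [(1 - 1/q)^(q/2) <= e^(-1/2)]. The target is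
    [N q <= (c q B)^(q/2)], and [c = K^2] solves [2 alpha c theta = 1] with [alpha = rho0 / 6]: the
    variance term then enters with weight exactly [theta]. The truncation keeps [N q] finite, so
    that it can be moved across the inequality, and the resulting bound does not depend on the
    truncation level. *)

Section log_kernel.
Context {R : realType}.
Implicit Types (x m s a b t : R).

(* The Bregman divergence of [u ln u] between [x + s] and [m + s]. *)
Definition breg x m s := (x + s) * (ln (x + s) - ln (m + s)) - (x - m).

Lemma ln_le_subr1 x : 0 < x -> ln x <= x - 1.
Proof.
move=> x0; have := @le_ln1Dx R (x - 1); rewrite (addrC 1) subrK; apply.
by rewrite ltrBrDr addNr.
Qed.

(** A Bregman divergence does not see affine terms of its generator, so [(x + s) ln (x + s)] may be
    replaced by [(x + s) * ln (1 + x / s) - x], whose derivative in [x] is [ln (1 + x / s)]. Each of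
    the three resulting pieces is integrable against [s^(beta - 1) ds] on its own. *)
Lemma bregE x m s : 0 <= x -> 0 <= m -> 0 < s ->
  breg x m s = ((x + s) * ln (1 + x / s) - x) - ((m + s) * ln (1 + m / s) - m)
               - (x - m) * ln (1 + m / s).
Proof.
move=> x0 m0 s0.
have H y : 0 <= y -> ln (1 + y / s) = ln (y + s) - ln s.
  move=> y0; rewrite -ln_div ?posrE //; last lra.
  by congr ln; field; rewrite gt_eqF.
rewrite /breg !H //; ring.
Qed.

(* With [u = x + s] and [v = m + s], [ln z <= z - 1] at [z = sqrt (v / u)] shows
   that the divergence is at least [(sqrt u - sqrt v)^2]. *)
Lemma breg_ge x m s : 0 <= x -> 0 <= m -> 0 < s ->
  (x - m) ^+ 2 / (2 * (x + m + 2 * s)) <= breg x m s.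
Proof.
move=> x0 m0 s0; set u := x + s; set v := m + s.
have u0 : 0 < u by rewrite /u; lra.
have v0 : 0 < v by rewrite /v; lra.
pose a := Num.sqrt u; pose b := Num.sqrt v.
have a0 : 0 < a by rewrite sqrtr_gt0.
have b0 : 0 < b by rewrite sqrtr_gt0.
have ua : u = a ^+ 2 by rewrite sqr_sqrtr // ltW.
have vb : v = b ^+ 2 by rewrite sqr_sqrtr // ltW.
have -> : x - m = u - v by rewrite /u /v; ring.
have -> : x + m + 2 * s = u + v by rewrite /u /v; ring.
have lnuv : ln u - ln v = - (2 * ln (b / a)).
  rewrite ua vb !lnXn // ln_div ?posrE // !mulr2n; ring.
have l1 : ln (b / a) <= b / a - 1 by apply: ln_le_subr1; rewrite divr_gt0.
have -> : breg x m s = u * (ln u - ln v) - (u - v) by rewrite /breg /u /v; ring.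
rewrite lnuv.
have h1 : (a - b) ^+ 2 <= u * - (2 * ln (b / a)) - (u - v).
  have : u * - (2 * (b / a - 1)) - (u - v) = (a - b) ^+ 2.
    by rewrite ua vb; field; rewrite gt_eqF.
  move=> <-; rewrite lerD2r ler_pM2l // lerN2 ler_pM2l //; lra.
apply: le_trans h1; rewrite ua vb ler_pdivrMr; last by nra.
have -> : (a ^+ 2 - b ^+ 2) ^+ 2 = (a - b) ^+ 2 * (a + b) ^+ 2 by ring.
rewrite ler_wpM2l ?sqr_ge0 //.
by have := sqr_ge0 (a - b); nra.
Qed.

Lemma breg_ge0 x m s : 0 <= x -> 0 <= m -> 0 < s -> 0 <= breg x m s.
Proof.
move=> x0 m0 s0; apply: le_trans (breg_ge x0 m0 s0).
rewrite divr_ge0 ?sqr_ge0 //; lra.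
Qed.

Lemma lnB_ge0 a b s : 0 <= b -> 0 < s -> b <= a -> 0 <= ln (a + s) - ln (b + s).
Proof. by move=> b0 s0 ba; rewrite subr_ge0 ler_ln ?posrE; lra. Qed.

Lemma mulr_lnB_ge0 a b s : 0 <= a -> 0 <= b -> 0 < s ->
  0 <= (a - b) * (ln (a + s) - ln (b + s)).
Proof.
move=> a0 b0 s0; have [ba|/ltW ab] := leP b a.
  by rewrite mulr_ge0 ?lnB_ge0 // subr_ge0.
by rewrite -mulrNN !opprB mulr_ge0 ?lnB_ge0 // subr_ge0.
Qed.

Lemma lnB_le a b s : 0 <= b -> 0 < s -> b <= a -> s * (ln (a + s) - ln (b + s)) <= a - b.
Proof.
move=> b0 s0 ba; rewrite -ln_div ?posrE; [|lra|lra].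
have h : ln ((a + s) / (b + s)) <= (a + s) / (b + s) - 1.
  by apply: ln_le_subr1; rewrite divr_gt0 //; lra.
have -> : a - b = (b + s) * ((a + s) / (b + s) - 1).
  by field; rewrite gt_eqF //; lra.
have h0 : 0 <= (a + s) / (b + s) - 1.
  by rewrite subr_ge0 ler_pdivlMr ?mul1r; lra.
apply: (@le_trans _ _ (s * ((a + s) / (b + s) - 1))); first by rewrite ler_pM2l.
by rewrite ler_wpM2r //; lra.
Qed.

(** Through [in_Dom_lipschitz] this puts [ln (f + s)] in [Dom] together with [f], so that the
    modified log-Sobolev inequality applies to [f + s]. *)
Lemma norm_lnB_le a b s : 0 <= a -> 0 <= b -> 0 < s ->
  `|ln (a + s) - ln (b + s)| <= s^-1 * `|a - b|.
Proof.
move=> a0 b0 s0; rewrite -(ler_pM2l s0) mulrA divff ?gt_eqF // mul1r.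
wlog ba : a b a0 b0 / b <= a.
  move=> W; have [/W ->//|/ltW ab] := leP b a.
  by rewrite distrC [leRHS]distrC W.
rewrite ger0_norm ?lnB_ge0 // ger0_norm ?subr_ge0 //; exact: lnB_le.
Qed.

(** After multiplication by [s] the logarithmic energy is bounded by the quadratic one, uniformly in
    [s]. This is the upper half of the limit [s -> oo]; [breg_ge] is the lower half. *)
Lemma mulr_lnB_le a b s : 0 <= a -> 0 <= b -> 0 < s ->
  s * ((a - b) * (ln (a + s) - ln (b + s))) <= (a - b) ^+ 2.
Proof.
move=> a0 b0 s0; wlog ba : a b a0 b0 / b <= a.
  move=> W; have [/W ->//|/ltW ab] := leP b a.
  have -> : (a - b) * (ln (a + s) - ln (b + s)) = (b - a) * (ln (b + s) - ln (a + s)) by ring.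
  by rewrite -sqrrN opprB W.
by rewrite mulrCA expr2 ler_wpM2l ?subr_ge0 ?lnB_le.
Qed.

End log_kernel.

Section shift.
Context {R : realType}.
Notation leb := (@lebesgue_measure R).

Lemma lebesgue_measure_shift (c : R) (A : set R) : measurable A ->
  pushforward leb (fun t => t + c : measurableTypeR R) A = leb A.
Proof.
have mc : measurable_fun setT (fun t : R => t + c : measurableTypeR R).
  by apply: measurable_funD.
move=> mA; apply/esym/lebesgue_measure_unique => //= _ [[a b]] _ <-.
rewrite /pushforward.
have -> : (fun t : R => t + c) @^-1` `]a, b] = `](a - c), (b - c)]%classic.
  by apply/seteqP; split => x /=; rewrite !in_itv /= ltrBlDr lerBrDr.
rewrite !lebesgue_measure_itv /= !lte_fin.
rewrite ltrD2r; case: ifP => // _.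
by rewrite -!EFinB; congr EFin; ring.
Qed.

Lemma ge0_integral_shift (c : R) (f : R -> \bar R) :
  measurable_fun setT f -> (forall x, 0 <= f x)%E ->
  (\int[leb]_t f (t + c)%R = \int[leb]_t f t)%E.
Proof.
move=> mf f0.
have mc : measurable_fun setT (fun t : R => t + c : measurableTypeR R).
  by apply: measurable_funD.
transitivity (\int[pushforward leb (fun t => t + c : measurableTypeR R)%R]_y f y)%E.
  by rewrite ge0_integral_pushforward.
by apply: eq_measure_integral => A mA _; exact: lebesgue_measure_shift.
Qed.

End shift.

Section kernel_integrals.
Context {R : realType} (beta : R) (beta0 : 0 < beta) (beta1 : beta < 1).
Notation leb := (@lebesgue_measure R).
Implicit Types (a x m t : R).

(* Under [s = e^t] the weight [s^(beta - 1) ds] becomes [e^(beta t) dt], and scaling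
   [a] becomes a translation of [t]. *)
Let L a t := expR (beta * t) * ln (1 + a / expR t).
Let phi x t := expR (beta * t) * ((x + expR t) * ln (1 + x / expR t) - x).

Let measurable_L a : measurable_fun setT (L a).
Proof.
apply: measurable_funM; first by apply: measurableT_comp => //; exact: measurable_funM.
apply: measurableT_comp => //; apply: measurable_funD => //.
apply: measurable_funM => //.
by under eq_fun do rewrite -expRN; apply: measurableT_comp => //; exact: measurableT_comp.
Qed.

Let measurable_phi x : measurable_fun setT (phi x).
Proof.
apply: measurable_funM; first by apply: measurableT_comp => //; exact: measurable_funM.
apply: measurable_funB => //; apply: measurable_funM => //.
  by apply: measurable_funD.
apply: measurableT_comp => //; apply: measurable_funD => //.
apply: measurable_funM => //.
by under eq_fun do rewrite -expRN; apply: measurableT_comp => //; exact: measurableT_comp.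
Qed.

Let L_ge0 a t : 0 <= a -> 0 <= L a t.
Proof.
by move=> a0; rewrite mulr_ge0 ?expR_ge0 ?ln_ge0 // lerDl divr_ge0 ?expR_ge0.
Qed.

Let phiE x t : 0 <= x -> phi x t = expR (beta * t) * breg x 0 (expR t).
Proof.
move=> x0; rewrite bregE ?expR_gt0 // /phi; congr (_ * _).
by rewrite !mul0r addr0 ln1 !mulr0 !subr0.
Qed.

Let phi_ge0 x t : 0 <= x -> 0 <= phi x t.
Proof. by move=> x0; rewrite phiE // mulr_ge0 ?expR_ge0 ?breg_ge0 ?expR_gt0. Qed.

Let L_scale a : 0 <= a ->
  (\int[leb]_t (L a t)%:E = (a `^ beta)%:E * \int[leb]_t (L 1 t)%:E)%E.
Proof.
rewrite le_eqVlt => /predU1P[<-|a0].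
  rewrite powR0 ?gt_eqF // mul0e integral0_eq // => t _.
  by rewrite /L mul0r addr0 ln1 mulr0.
rewrite -(@ge0_integral_shift R (ln a)); first last.
- by move=> t; rewrite lee_fin L_ge0 // ltW.
- exact/measurable_EFinP.
rewrite -ge0_integralZl_EFin ?powR_ge0 //; first last.
- apply/measurable_EFinP; exact: measurable_L.
- by move=> t _; rewrite lee_fin L_ge0 //.
apply: eq_integral => t _; rewrite -EFinM; congr EFin.
rewrite /L (mulrDr beta) !expRD lnK ?posrE // /powR gt_eqF //.
have -> : a / (expR t * a) = 1 / expR t by field; rewrite !gt_eqF ?expR_gt0.
ring.
Qed.

Let phi_scale x : 0 <= x ->
  (\int[leb]_t (phi x t)%:E = (x `^ (beta + 1))%:E * \int[leb]_t (phi 1 t)%:E)%E.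
Proof.
rewrite le_eqVlt => /predU1P[<-|a0].
  rewrite powR0 ?gt_eqF ?addr_gt0 // mul0e integral0_eq // => t _.
  by rewrite /phi mul0r addr0 ln1 mulr0 subr0 mulr0.
rewrite -(@ge0_integral_shift R (ln x)); first last.
- by move=> t; rewrite lee_fin phi_ge0 // ltW.
- exact/measurable_EFinP.
rewrite -ge0_integralZl_EFin ?powR_ge0 //; first last.
- apply/measurable_EFinP; exact: measurable_phi.
- by move=> t _; rewrite lee_fin phi_ge0 //.
apply: eq_integral => t _; rewrite -EFinM; congr EFin.
have -> : x `^ (beta + 1) = expR (beta * ln x) * x.
  by rewrite /powR gt_eqF // mulrDl mul1r expRD [X in _ * X]lnK.
rewrite /phi (mulrDr beta) !expRD lnK ?posrE //.
have -> : x / (expR t * x) = 1 / expR t by field; rewrite !gt_eqF ?expR_gt0.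
ring.
Qed.

(** The inequality [e^t * ln (1 + e^-t) <= 1] makes the integral of [phi 1] finite as soon as that
    of [L 1] is. *)
Let phi_le_L t : phi 1 t <= L 1 t.
Proof.
rewrite /phi /L ler_pM2l ?expR_gt0 // lerBlDr mulrDl mul1r lerD2l.
rewrite mulrC -ler_pdivlMr ?expR_gt0 // mul1r.
have := @le_ln1Dx R (expR t)^-1; apply.
by rewrite (@lt_trans _ _ 0) // invr_gt0 expR_gt0.
Qed.

(** A common exponential decay rate of [L 1]: [1 - beta] at [+oo], where [ln (1 + e^-t) <= e^-t],
    and [beta / 2] at [-oo], where the other half of [beta] absorbs the linear growth of
    [ln (1 + e^-t)]. *)
Let eta := Num.min (beta / 2) (1 - beta).

Let eta0 : 0 < eta.
Proof. by rewrite lt_min divr_gt0 //= subr_gt0. Qed.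

Let C := (2 / beta) * 2 + 1.

(** Exponential densities are the majorant because their integral is known to be 1; each of the two
    takes care of one half-line. *)
Let L1_le t : L 1 t <= C / eta * (exponential_pdf eta t + exponential_pdf eta (- t)).
Proof.
have C0 : 0 < 2 / beta by rewrite divr_gt0.
have pge0 u : 0 <= exponential_pdf eta u by apply: exponential_pdf_ge0; exact: ltW.
have [t0|t0] := leP 0 t.
  apply: (@le_trans _ _ (C / eta * exponential_pdf eta t)); last first.
    by rewrite ler_wpM2l ?lerDl // divr_ge0 ?ltW // /C; lra.
  rewrite exponential_pdfE // mulrA divfK ?gt_eqF //.
  apply: (@le_trans _ _ (expR (beta * t) * expR (- t))).
    rewrite /L ler_pM2l ?expR_gt0 // mul1r expRN; apply: le_ln1Dx.
    by rewrite (@lt_trans _ _ 0) // invr_gt0 expR_gt0.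
  rewrite -expRD; apply: (@le_trans _ _ (expR (- eta * t))).
    rewrite ler_expR; have : eta <= 1 - beta by rewrite ge_min lexx orbT.
    nra.
  by rewrite ler_peMl ?expR_ge0 // /C; lra.
apply: (@le_trans _ _ (C / eta * exponential_pdf eta (- t))); last first.
  by rewrite ler_wpM2l ?lerDr // divr_ge0 ?ltW // /C; lra.
rewrite exponential_pdfE; last lra.
rewrite mulrA divfK ?gt_eqF // mulrNN.
set b2 := beta / 2; have b20 : 0 < b2 by rewrite divr_gt0.
set y := expR (- t); have y1 : 1 <= y by rewrite /y -expR0 ler_expR; lra.
(* Logarithmic growth is traded for the small power [b2]: [ln (1 + y) = ln ((1 + y)^b2) / b2], then
   [ln z <= z], [1 + y <= 2 y] and [2^b2 <= 2]. *)
have lny : ln (1 + y) <= b2^-1 * (2 * y `^ b2).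
  rewrite -[ln _](mulKf (lt0r_neq0 b20)) ler_pM2l ?invr_gt0 // -ln_powR.
  apply: le_trans (ltW (ln_sublinear _)) _; first by apply: powR_gt0; lra.
  apply: (@le_trans _ _ ((2 * y) `^ b2)).
    by apply: ge0_ler_powR; rewrite ?nnegrE; lra.
  rewrite powRM ?ler_wpM2r ?powR_ge0 //; last lra.
  rewrite -[leRHS]powRr1 //; apply: ler_powR; first exact: ler1n.
  by rewrite /b2; move: beta1; lra.
rewrite /L mul1r -expRN -/y.
apply: (@le_trans _ _ (expR (beta * t) * (b2^-1 * (2 * y `^ b2)))).
  by rewrite ler_pM2l ?expR_gt0.
have -> : y `^ b2 = expR (- t * b2) by rewrite /y expRM.
have -> : b2^-1 = 2 / beta by rewrite invf_div.
rewrite mulrCA (mulrCA _ 2) -expRD mulrA.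
apply: ler_pM; [lra|exact: expR_ge0|rewrite /C; lra|].
have : eta <= b2 by rewrite ge_min lexx.
rewrite ler_expR /b2; nra.
Qed.

Let int_pdfN : (\int[leb]_t (exponential_pdf eta (- t))%:E = 1)%E.
Proof.
rewrite -(integral_exponential_pdf eta0).
have mp := @measurable_exponential_pdf R eta.
transitivity (\int[pushforward leb (-%R : _ -> measurableTypeR R)]_y
    (exponential_pdf eta y)%:E)%E.
  rewrite ge0_integral_pushforward //=; first exact/measurable_EFinP.
  by move=> y; rewrite lee_fin exponential_pdf_ge0 // ltW.
by apply: eq_measure_integral => A mA _; exact: lebesgue_measureN.
Qed.

Let int_L_lty : (\int[leb]_t (L 1 t)%:E < +oo)%E.
Proof.
have mp := @measurable_exponential_pdf R eta.
have mpN : measurable_fun setT (fun t => exponential_pdf eta (- t)).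
  by apply: measurableT_comp.
have p0 t : 0 <= exponential_pdf eta t by apply: exponential_pdf_ge0; exact: ltW.
have C0 : 0 <= C / eta by rewrite divr_ge0 ?ltW // /C addr_gt0 // mulr_gt0 // divr_gt0.
apply: (@le_lt_trans _ _ (\int[leb]_t (C / eta * (exponential_pdf eta t + exponential_pdf eta (- t)))%:E)%E).
  apply: ge0_le_integral => //.
  - by move=> t _; rewrite lee_fin L_ge0 //.
  - by apply/measurable_EFinP; exact: measurable_L.
  - by apply/measurable_EFinP/measurable_funM => //; exact: measurable_funD.
  - by move=> t _; rewrite lee_fin L1_le.
under eq_integral do rewrite EFinM EFinD.
rewrite ge0_integralZl_EFin //; last first.
- by apply: emeasurable_funD; exact/measurable_EFinP.
- by move=> t _; rewrite adde_ge0 ?lee_fin.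
rewrite ge0_integralD //; [|by move=> *; rewrite lee_fin|by apply/measurable_EFinP|by move=> *; rewrite lee_fin|exact/measurable_EFinP].
by rewrite integral_exponential_pdf // int_pdfN -EFinD -EFinM ltry.
Qed.

(* [F <= 3 * G] is the nonnegativity of the divergence integral at [x = 2], [m = 1]. *)
Lemma log_kernel_integrals : exists F G : R, [/\ 0 < F, F <= 3 * G,
  forall a b, 0 <= b -> b <= a ->
    (\int[leb]_t (expR (beta * t) * (ln (a + expR t) - ln (b + expR t)))%:E =
     (F * (a `^ beta - b `^ beta))%:E)%E &
  forall x m, 0 <= x -> 0 <= m ->
    (\int[leb]_t (expR (beta * t) * breg x m (expR t))%:E =
     (G * (x `^ (beta + 1) - m `^ (beta + 1)) - F * m `^ beta * (x - m))%:E)%E].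
Proof.
pose F := fine (\int[leb]_t (L 1 t)%:E).
pose G := fine (\int[leb]_t (phi 1 t)%:E).
have intphi_le : (\int[leb]_t (phi 1 t)%:E <= \int[leb]_t (L 1 t)%:E)%E.
  apply: ge0_le_integral => //.
  - by move=> t _; rewrite lee_fin phi_ge0 //.
  - by apply/measurable_EFinP; exact: measurable_phi.
  - by apply/measurable_EFinP; exact: measurable_L.
  - by move=> t _; rewrite lee_fin phi_le_L.
have FE : (\int[leb]_t (L 1 t)%:E = F%:E)%E.
  rewrite fineK // ge0_fin_numE //.
  by apply: integral_ge0 => t _; rewrite lee_fin L_ge0 //.
have GE : (\int[leb]_t (phi 1 t)%:E = G%:E)%E.
  rewrite fineK // ge0_fin_numE ?(le_lt_trans intphi_le) //.
  by apply: integral_ge0 => t _; rewrite lee_fin phi_ge0 //.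
have iL a : 0 <= a -> leb.-integrable setT (EFin \o L a).
  move=> a0; apply/integrableP; split; first by apply/measurable_EFinP; exact: measurable_L.
  under eq_integral do rewrite /= ger0_norm ?L_ge0 //.
  by rewrite L_scale // FE -EFinM ltry.
have iphi x : 0 <= x -> leb.-integrable setT (EFin \o phi x).
  move=> x0; apply/integrableP; split; first by apply/measurable_EFinP; exact: measurable_phi.
  under eq_integral do rewrite /= ger0_norm ?phi_ge0 //.
  by rewrite phi_scale // GE -EFinM ltry.
have IL a : 0 <= a -> (\int[leb]_t (L a t)%:E = (F * a `^ beta)%:E)%E.
  by move=> a0; rewrite L_scale // FE -EFinM mulrC.
have Iphi x : 0 <= x -> (\int[leb]_t (phi x t)%:E = (G * x `^ (beta + 1))%:E)%E.
  by move=> x0; rewrite phi_scale // GE -EFinM mulrC.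
have Ibreg x m : 0 <= x -> 0 <= m ->
    (\int[leb]_t (expR (beta * t) * breg x m (expR t))%:E =
     (G * (x `^ (beta + 1) - m `^ (beta + 1)) - F * m `^ beta * (x - m))%:E)%E.
  move=> x0 m0.
  under eq_integral => t _.
    have -> : expR (beta * t) * breg x m (expR t) = phi x t - phi m t - (x - m) * L m t.
      by rewrite bregE ?expR_gt0 // /phi /L; ring.
    rewrite EFinB EFinB (EFinM (x - m)).
    over.
  rewrite integralB //; last 2 first.
  - by apply: integrableB => //; exact: iphi.
  - by apply: integrableZl => //; exact: iL.
  rewrite integralB //; [|exact: iphi|exact: iphi].
  rewrite integralZl //; last exact: iL.
  rewrite !Iphi // IL // -EFinM -!EFinB; congr EFin; ring.
exists F, G; split => //.
- have F0 : 0 <= F by rewrite fine_ge0 // integral_ge0 // => t _; rewrite lee_fin L_ge0 //.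
  rewrite lt_neqAle F0 andbT eq_sym; apply/negP => /eqP F_eq0.
  (* Positivity of [F]: on [[0, 1]] one has [e^(beta t) >= 1] and [e^-t >= e^-1], so [L 1] stays
     above a positive constant there. *)
  have [c c0 Lc] : exists2 c, 0 < c & forall t, 0 <= t <= 1 -> c <= L 1 t.
    exists (ln (1 + (expR 1)^-1)).
      by rewrite ln_gt0 // ltrDl invr_gt0 expR_gt0.
    move=> t /andP[t0 t1]; rewrite /L mul1r.
    rewrite -[leLHS]mul1r ler_pM ?ln_ge0 // ?lerDl ?invr_ge0 ?expR_ge0 //.
      by rewrite -expR0 ler_expR mulr_ge0 // ltW.
    rewrite ler_ln ?posrE ?addr_gt0 ?invr_gt0 ?expR_gt0 //.
    by rewrite lerD2l lef_pV2 ?posrE ?expR_gt0 // ler_expR.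
  have : (c%:E * leb `[0%R, 1%R] <= \int[leb]_t (L 1 t)%:E)%E.
    rewrite -integral_cst //.
    apply: (@le_trans _ _ (\int[leb]_(t in `[0%R, 1%R]) (L 1 t)%:E)%E).
      apply: ge0_le_integral => //.
      - by move=> *; rewrite lee_fin ltW.
      - by apply/measurable_EFinP; apply: measurable_funTS; exact: measurable_L.
    apply: ge0_subset_integral => //.
    - by apply/measurable_EFinP; exact: measurable_L.
    - by move=> t _; rewrite lee_fin L_ge0 //.
  rewrite FE F_eq0 lebesgue_measure_itv /= lte_fin ltr01 oppr0 adde0 mule1 lee_fin.
  by rewrite leNgt c0.
- have : (0 <= \int[leb]_t (expR (beta * t) * breg 2 1 (expR t))%:E)%E.
    apply: integral_ge0 => t _.
    by rewrite lee_fin mulr_ge0 ?expR_ge0 ?breg_ge0 ?expR_gt0.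
  rewrite Ibreg // lee_fin !powR1 mulr1 subr_ge0.
  have -> : (2 - 1 : R) = 1 by lra.
  rewrite mulr1 => /le_trans; apply; rewrite mulrC ler_wpM2r //.
    by rewrite fine_ge0 // integral_ge0 // => t _; rewrite lee_fin phi_ge0 //.
  rewrite lerBlDr (_ : 3 + 1 = 2 `^ 2); last by rewrite powR_mulrn // expr2; lra.
  by apply: ler_powR; [exact: ler1n|move: beta1; lra].
- move=> a b b0 ba; have a0 := le_trans b0 ba.
  under eq_integral => t _.
    rewrite (_ : _ - _ = ln (1 + a / expR t) - ln (1 + b / expR t)); last first.
      have H y : 0 <= y -> ln (1 + y / expR t) = ln (y + expR t) - ln (expR t).
        move=> y0; rewrite -ln_div ?posrE ?ltr_wpDl ?expR_gt0 //.
        by congr ln; field; rewrite gt_eqF ?expR_gt0.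
      by rewrite !H //; ring.
    rewrite mulrBr EFinB -/(L a t) -/(L b t).
    over.
  rewrite integralB //; [|exact: iL|exact: iL].
  by rewrite !IL // -EFinB mulrBr.
Qed.

End kernel_integrals.

(** * Glauber dynamics *)

Section power_measurability.
Context {J : Type} {dT : measure_display} {T : measurableType dT}.

Lemma measurable_coord (j : J) : measurable_fun setT (fun x : power J T => x j).
Proof.
move=> _ B mB; apply: sub_sigma_algebra; exists j => //.
by exists B.
Qed.

Lemma measurable_fun_power d1 (T1 : measurableType d1) (f : T1 -> power J T) :
  (forall j, measurable_fun setT (fun w => f w j)) -> measurable_fun setT f.
Proof.
move=> mf; apply: (@measurability _ _ T1 (power J T) setT f (@cylinders J dT T)) => //.
move=> _ [_ [j _ [B mB <-]] <-]; rewrite !setTI.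
by rewrite -[X in measurable X]setTI; exact: (mf j measurableT B mB).
Qed.

End power_measurability.
Arguments measurable_coord {J dT T} j.

Section resampling_measurability.
Context {I : finType} {dE : measure_display} {E : measurableType dE}.

Lemma measurable_restr (i : I) : measurable_fun setT (@restr I dE E i).
Proof. by apply: measurable_fun_power => j; exact: measurable_coord. Qed.

Lemma measurable_Xi dO (Omega : measurableType dO) (X : Omega -> power I E)
    (X' : I -> Omega -> E) (i : I) :
  measurable_fun setT X -> measurable_fun setT (X' i) ->
  measurable_fun setT (Xi X X' i).
Proof.
move=> mX mX'; apply: measurable_fun_power => j; rewrite /Xi /resample.
have [_|_] := eqVneq j i; first exact: mX'.
exact: (measurableT_comp (measurable_coord j) mX).
Qed.

End resampling_measurability.
Arguments measurable_restr {I dE E} i.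

Section probability_constants.
Context d (T : measurableType d) (R : realType) (P : probability T R).

Lemma integral_probability_cst (c : R) : (\int[P]__ c%:E = c%:E)%E.
Proof.
rewrite integral_cst // [X in (_ * X)%E](_ : _ = 1%E) ?mule1 //.
exact: probability_setT.
Qed.

Lemma Rintegral_probability_cst (c : R) : \int[P]__ c = c.
Proof. by rewrite /Rintegral integral_probability_cst. Qed.

Lemma integrable_probability_bounded (h : T -> R) M : measurable_fun setT h ->
  (forall x, 0 <= h x <= M) -> P.-integrable setT (EFin \o h).
Proof.
move=> mh hM; apply: measurable_bounded_integrable => //.
  by apply: (@le_lt_trans _ _ 1%E); [exact: probability_le1|exact: ltry].
exists M; split; first exact: num_real.
move=> y My x _ /=; have /andP[h1 h2] := hM x.
by rewrite ger0_norm // (le_trans h2) // ltW.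
Qed.

End probability_constants.

Section square_integrable.
Context d (T : measurableType d) (R : realType) (m : {measure set T -> \bar R}).

Lemma sqr_lty_integrableM (u v : T -> R) :
  measurable_fun setT u -> measurable_fun setT v ->
  (\int[m]_w (u w ^+ 2)%:E < +oo)%E -> (\int[m]_w (v w ^+ 2)%:E < +oo)%E ->
  m.-integrable setT (fun w => (u w * v w)%:E).
Proof.
move=> mu_ mv iu iv.
have sq (h : T -> R) : measurable_fun setT h -> (\int[m]_w (h w ^+ 2)%:E < +oo)%E ->
    m.-integrable setT (fun w => (h w ^+ 2)%:E).
  move=> mh ih; apply/integrableP; split.
    by apply/measurable_EFinP; exact: measurable_funX.
  by under eq_integral do rewrite gee0_abs ?lee_fin ?sqr_ge0 //.
apply: (@le_integrable _ _ _ m _ measurableT _ (fun w => (u w ^+ 2)%:E + (v w ^+ 2)%:E)%E).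
- by apply/measurable_EFinP; exact: measurable_funM.
- move=> w _ /=; rewrite lee_fin normrM (ger0_norm (addr_ge0 _ _)) ?sqr_ge0 //.
  rewrite -[u w ^+ 2]real_normK ?num_real // -[v w ^+ 2]real_normK ?num_real //.
  have := sqr_ge0 (`|u w| - `|v w|); have := mulr_ge0 (normr_ge0 (u w)) (normr_ge0 (v w)).
  by nra.
- by apply: integrableD => //; exact: sq.
Qed.

End square_integrable.

Section dom.
Context (R : realType) (I : finType) (dE : measure_display)
  (E : measurableType dE) (dO : measure_display) (Omega : measurableType dO)
  (P : probability Omega R) (X : Omega -> power I E) (X' : I -> Omega -> E).
Hypotheses (mX : measurable_fun setT X) (mX' : forall i, measurable_fun setT (X' i)).
Implicit Types f g h : power I E -> R.

Let mXi i : measurable_fun setT (Xi X X' i).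
Proof. exact: measurable_Xi. Qed.

Lemma measurable_increment f i : measurable_fun setT f ->
  measurable_fun setT (fun w => f (X w) - f (Xi X X' i w)).
Proof.
by move=> mf; apply: measurable_funB; [exact: (measurableT_comp mf mX)|exact: (measurableT_comp mf (mXi i))].
Qed.

Lemma measurable_increment_sqr f i : measurable_fun setT f ->
  measurable_fun setT (fun w => ((f (X w) - f (Xi X X' i w)) ^+ 2)%:E).
Proof.
by move=> mf; apply/measurable_EFinP; apply: measurable_funX; exact: measurable_increment.
Qed.

Lemma in_Dom_lty f i : in_Dom P X X' f ->
  (\int[P]_w ((f (X w) - f (Xi X X' i w)) ^+ 2)%:E < +oo)%E.
Proof.
case=> mf; apply: le_lt_trans; rewrite (bigD1 i) //= leeDl // sume_ge0 // => j _.
by apply: integral_ge0 => w _; rewrite lee_fin sqr_ge0.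
Qed.

Lemma glauber_integrable f g i : in_Dom P X X' f -> in_Dom P X X' g ->
  P.-integrable setT (fun w =>
    ((f (X w) - f (Xi X X' i w)) * (g (X w) - g (Xi X X' i w)))%:E).
Proof.
move=> Df Dg; apply: sqr_lty_integrableM; try exact: in_Dom_lty.
- by apply: measurable_increment; case: Df.
- by apply: measurable_increment; case: Dg.
Qed.

(** The real-valued form takes the finite part of each integral, which would hide an infinite value.
    Products of increments of two functions in [Dom] are integrable, so nothing is lost and the
    comparisons can be made in the extended reals. *)
Lemma EFin_glauber_form f g : in_Dom P X X' f -> in_Dom P X X' g ->
  ((glauber_form P X X' f g)%:E =
   2^-1%:E * \sum_(i : I) \int[P]_w
     ((f (X w) - f (Xi X X' i w)) * (g (X w) - g (Xi X X' i w)))%:E)%E.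
Proof.
move=> Df Dg; rewrite /glauber_form EFinM -sumEFin; congr (_ * _)%E.
apply: eq_bigr => i _; rewrite fineK //.
by apply: integrable_fin_num => //; exact: glauber_integrable.
Qed.

(** Only increments enter [Dom], so a pointwise comparison of increments transports membership. It
    serves for shifts, logarithms, positive parts and truncations of [f]. *)
Lemma in_Dom_lipschitz f h c : measurable_fun setT h ->
  (forall x y, `|h x - h y| <= c * `|f x - f y|) ->
  in_Dom P X X' f -> in_Dom P X X' h.
Proof.
move=> mh hf Df; have [mf _] := Df; split=> //.
apply: lte_sum_pinfty => i _.
apply: (@le_lt_trans _ _ (\int[P]_w (c ^+ 2 * (f (X w) - f (Xi X X' i w)) ^+ 2)%:E)%E).
  apply: ge0_le_integral => //.
  - by move=> w _; rewrite lee_fin sqr_ge0.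
  - exact: measurable_increment_sqr.
  - apply/measurable_EFinP/measurable_funM => //.
    by apply: measurable_funX; exact: measurable_increment.
  - move=> w _; rewrite lee_fin -[leLHS]real_normK ?num_real //.
    rewrite -[X in _ <= _ * X]real_normK ?num_real // -exprMn.
    by rewrite lerXn2r ?nnegrE // (le_trans _ (hf _ _)).
under eq_integral do rewrite EFinM.
rewrite ge0_integralZl_EFin ?sqr_ge0 //; last 2 first.
- by move=> w _; rewrite lee_fin sqr_ge0.
- exact: measurable_increment_sqr.
by rewrite lte_mul_pinfty ?lee_fin ?sqr_ge0 // in_Dom_lty.
Qed.

End dom.

Lemma lebesgue_tonelli d (T : measurableType d) (R : realType)
    (m : {sigma_finite_measure set T -> \bar R}) (h : R -> T -> R) :
  measurable_fun setT (fun z : measurableTypeR R * T => h z.1 z.2) ->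
  (forall t x, 0 <= h t x) ->
  measurable_fun setT (fun t => \int[m]_x (h t x)%:E)%E /\
  (\int[@lebesgue_measure R]_t \int[m]_x (h t x)%:E =
   \int[m]_x \int[@lebesgue_measure R]_t (h t x)%:E)%E.
Proof.
move=> mh h0; pose H (z : measurableTypeR R * T) := (h z.1 z.2)%:E.
have mH : measurable_fun setT H by exact/measurable_EFinP.
have H0 z : (0 <= H z)%E by rewrite lee_fin.
split; first exact: (measurable_fun_fubini_tonelli_F (m2 := m) H mH H0).
exact: (fubini_tonelli (m1 := @lebesgue_measure R) (m2 := m) H mH H0).
Qed.

Lemma powR_increment_ge0 (R : realType) (a b c : R) : 0 <= a -> 0 <= b -> 0 <= c ->
  0 <= (a - b) * (a `^ c - b `^ c).
Proof.
move=> a0 b0 c0; wlog ba : a b a0 b0 / b <= a.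
  move=> W; have [/W ->//|/ltW ab] := leP b a.
  by rewrite -mulrNN !opprB W.
by rewrite mulr_ge0 ?subr_ge0 // ge0_ler_powR.
Qed.

(** The kernel formula holds for ordered arguments, where the integrand is nonnegative; the factor
    [a - b] makes both sides symmetric and removes the order. *)
Lemma lnB_increment_integral (R : realType) (beta F a b : R) : 0 <= a -> 0 <= b ->
  (forall a b, 0 <= b -> b <= a ->
    (\int[@lebesgue_measure R]_t (expR (beta * t) * (ln (a + expR t) - ln (b + expR t)))%:E =
     (F * (a `^ beta - b `^ beta))%:E)%E) ->
  (\int[@lebesgue_measure R]_t
     (expR (beta * t) * ((a - b) * (ln (a + expR t) - ln (b + expR t))))%:E =
   (F * ((a - b) * (a `^ beta - b `^ beta)))%:E)%E.
Proof.
move=> a0 b0 IF; wlog ba : a b a0 b0 / b <= a.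
  move=> W; have [/W ->//|/ltW ab] := leP b a.
  have -> : F * ((a - b) * (a `^ beta - b `^ beta)) = F * ((b - a) * (b `^ beta - a `^ beta)) by ring.
  by rewrite -W //; apply: eq_integral => t _; congr EFin; ring.
under eq_integral do rewrite mulrCA EFinM.
rewrite ge0_integralZl_EFin ?subr_ge0 //; last 2 first.
- by move=> t _; rewrite lee_fin mulr_ge0 ?expR_ge0 ?lnB_ge0 ?expR_gt0.
- apply/measurable_EFinP; apply: measurable_funM.
    by apply: measurableT_comp => //; exact: measurable_funM.
  by apply: measurable_funB; apply: measurableT_comp => //; exact: measurable_funD.
by rewrite IF // -EFinM mulrCA.
Qed.

(** * Beckner and Poincare inequalities *)

Section mlsi_beckner.
Context (R : realType) (I : finType) (dE : measure_display)
  (E : measurableType dE) (mu : probability (power I E) R)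
  (dO : measure_display) (Omega : measurableType dO)
  (P : probability Omega R) (X : Omega -> power I E) (X' : I -> Omega -> E).
Hypotheses (mX : measurable_fun setT X) (mX' : forall i, measurable_fun setT (X' i)).
Variables (rho0 : R) (rho0_gt0 : 0 < rho0).
Hypothesis mlsi : modified_log_sobolev mu P X X' rho0.
Implicit Types f g h : power I E -> R.
Notation leb := (@lebesgue_measure R).

(** Adding [s] leaves the increments of [f] unchanged, so the energy of [f + s] is that of [f]
    against [ln (f + s)]. The inequality is stated in the extended reals, ready to be integrated in
    [s] by Tonelli. *)
Lemma mlsi_breg f s : (forall x, 0 <= f x) -> in_Dom P X X' f -> 0 < s ->
  mu.-integrable setT (EFin \o f) /\
  (rho0%:E * \int[mu]_x (breg (f x) (\int[mu]_x f x)%R s)%:E <=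
   2^-1%:E * \sum_(i : I) \int[P]_w
     ((f (X w) - f (Xi X X' i w)) *
      (ln (f (X w) + s) - ln (f (Xi X X' i w) + s)))%:E)%E.
Proof.
move=> f0 Df s0; have [mf _] := Df.
have fs_gt0 x : 0 < f x + s by rewrite ltr_wpDl.
have Dfs : in_Dom P X X' (fun x => f x + s).
  apply: (in_Dom_lipschitz (c := 1) mX mX' _ _ Df); first exact: measurable_funD.
  by move=> x y; rewrite mul1r (_ : f x + s - (f y + s) = f x - f y) //; ring.
have Dln : in_Dom P X X' (fun x => ln (f x + s)).
  apply: (in_Dom_lipschitz (c := s^-1) mX mX' _ _ Df).
    by apply: measurableT_comp => //; exact: measurable_funD.
  by move=> x y; exact: norm_lnB_le.
have [ifs ifsln ent_le] := mlsi fs_gt0 Dfs Dln.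
have icst c : mu.-integrable setT (EFin \o cst c) by exact: finite_measure_integrable_cst.
have if_ : mu.-integrable setT (EFin \o f).
  rewrite (_ : f = (fun x => f x + s) \- cst s).
    by apply: (@integrableB _ _ _ mu setT measurableT (EFin \o (fun x => f x + s)) (EFin \o cst s)).
  by apply/funext => x /=; rewrite addrK.
split => //.
set m := \int[mu]_x f x.
have Ics c : \int[mu]_x (cst c x) = c.
  exact: Rintegral_probability_cst.
have Ifs : \int[mu]_x (f x + s) = m + s.
  by rewrite (@RintegralD _ _ _ mu setT f (cst s)) // Ics.
pose l := ln (m + s).
(* The divergence is [(f + s) ln (f + s)] minus an affine function of [f] whose mean is
   [(m + s) * ln (m + s)]: its mean is the entropy of [f + s]. *)
have bregE' x : breg (f x) m s = (f x + s) * ln (f x + s) - (l * (f x + s) + (f x - m)).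
  by rewrite /breg -/l; ring.
have ilf : mu.-integrable setT (EFin \o (fun x => l * (f x + s))).
  by apply: (@integrableZl _ _ _ mu setT measurableT l (EFin \o (fun x => f x + s))).
have ifm : mu.-integrable setT (EFin \o (fun x => f x - m)).
  by apply: (@integrableB _ _ _ mu setT measurableT (EFin \o f) (EFin \o cst m)).
have ilfm : mu.-integrable setT (EFin \o (fun x => l * (f x + s) + (f x - m))).
  exact: (@integrableD _ _ _ mu setT measurableT (EFin \o (fun x => l * (f x + s)))
           (EFin \o (fun x => f x - m))).
have ibreg : mu.-integrable setT (fun x => (breg (f x) m s)%:E).
  under [X in integrable _ _ X]eq_fun do rewrite bregE'.
  exact: (@integrableB _ _ _ mu setT measurableT (EFin \o (fun x => (f x + s) * ln (f x + s)))
           (EFin \o (fun x => l * (f x + s) + (f x - m)))).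
have Ibreg : \int[mu]_x (breg (f x) m s) = entropy mu (fun x => f x + s).
  under eq_Rintegral do rewrite bregE'.
  rewrite RintegralB // RintegralD // RintegralZl // RintegralB //.
    by rewrite Ifs -/m (Ics m) subrr addr0 /entropy Ifs -/l; ring.
  exact: icst.
rewrite [leLHS](_ : _ = (rho0 * entropy mu (fun x => f x + s))%:E); last first.
  by rewrite EFinM -Ibreg; congr (_ * _)%E; rewrite fineK //; exact: integrable_fin_num.
apply: (@le_trans _ _ (glauber_form P X X' (fun x => f x + s) (fun x => ln (f x + s)))%:E).
  by rewrite lee_fin.
rewrite (EFin_glauber_form mX mX' Dfs Dln).
rewrite le_eqVlt; apply/orP; left; apply/eqP; congr (_ * _)%E.
apply: eq_bigr => i _; apply: eq_integral => w _; by congr EFin; ring.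
Qed.

Lemma mlsi_beckner_lt2 p : 1 < p < 2 -> beckner mu P X X' p (rho0 / 6).
Proof.
move=> /andP[p1 p2] f f0 Df Dfp; have [mf _] := Df.
pose beta := p - 1.
have b0 : 0 < beta by rewrite /beta; lra.
have b1 : beta < 1 by rewrite /beta; lra.
have [F [G [F0 FG IF IG]]] := log_kernel_integrals b0 b1.
have pE : beta + 1 = p by rewrite /beta; ring.
have G0 : 0 < G by lra.
pose m := \int[mu]_x f x.
have m0 : 0 <= m by apply: Rintegral_ge0.
have [if_ _] := mlsi_breg f0 Df ltr01.
have H t := (mlsi_breg f0 Df (expR_gt0 t)).2.
pose J t x := expR (beta * t) * breg (f x) m (expR t).
pose q i w t := (f (X w) - f (Xi X X' i w)) *
  (ln (f (X w) + expR t) - ln (f (Xi X X' i w) + expR t)).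
pose Q i t w := expR (beta * t) * q i w t.
have mXi i : measurable_fun setT (Xi X X' i) by exact: measurable_Xi.
have mf1 : measurable_fun setT (fun w => f (X w)) by exact: measurableT_comp.
have mf2 i : measurable_fun setT (fun w => f (Xi X X' i w)) by exact: measurableT_comp.
have J0 t x : 0 <= J t x by rewrite mulr_ge0 ?expR_ge0 ?breg_ge0 ?expR_gt0.
have Q0 i t w : 0 <= Q i t w by rewrite mulr_ge0 ?expR_ge0 ?mulr_lnB_ge0 ?expR_gt0.
have mE d (T : measurableType d) : measurable_fun setT (fun z : measurableTypeR R * T => expR z.1).
  by apply: measurableT_comp.
have mEb d (T : measurableType d) : measurable_fun setT (fun z : measurableTypeR R * T => expR (beta * z.1)).
  by apply: measurableT_comp => //; exact: measurable_funM.
have mJ : measurable_fun setT (fun z : measurableTypeR R * power I E => J z.1 z.2).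
  have mf' : measurable_fun setT (fun z : measurableTypeR R * power I E => f z.2).
    exact: measurableT_comp.
  have mE' := mE _ (power I E).
  rewrite /J /breg; apply: measurable_funM; first exact: mEb.
  apply: measurable_funB; last exact: measurable_funB.
  apply: measurable_funM; first exact: measurable_funD.
  by apply: measurable_funB; apply: measurableT_comp => //; exact: measurable_funD.
have mQ i : measurable_fun setT (fun z : measurableTypeR R * Omega => Q i z.1 z.2).
  have mf1' : measurable_fun setT (fun z : measurableTypeR R * Omega => f (X z.2)).
    exact: (measurableT_comp mf1 measurable_snd).
  have mf2' : measurable_fun setT (fun z : measurableTypeR R * Omega => f (Xi X X' i z.2)).
    exact: (measurableT_comp (mf2 i) measurable_snd).
  have mE' := mE _ Omega.
  rewrite /Q /q; apply: measurable_funM; first exact: mEb.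
  apply: measurable_funM; first exact: measurable_funB.
  by apply: measurable_funB; apply: measurableT_comp => //; exact: measurable_funD.
have [mIJ TJ] := lebesgue_tonelli mu mJ J0.
have TQ i := lebesgue_tonelli P (mQ i) (Q0 i).
have mJt t : measurable_fun setT (fun x => (breg (f x) m (expR t))%:E).
  rewrite /breg; apply/measurable_EFinP; apply: measurable_funB; last exact: measurable_funB.
  apply: measurable_funM; first exact: measurable_funD.
  by apply: measurable_funB => //; apply: measurableT_comp => //; exact: measurable_funD.
have mqt i t : measurable_fun setT (fun w => (q i w t)%:E).
  apply/measurable_EFinP; apply: measurable_funM; first exact: measurable_funB.
  by apply: measurable_funB; apply: measurableT_comp => //; exact: measurable_funD.
have Ht t : (rho0%:E * \int[mu]_x (J t x)%:E <= 2^-1%:E * \sum_(i : I) \int[P]_w (Q i t w)%:E)%E.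
  have -> : (\int[mu]_x (J t x)%:E = (expR (beta * t))%:E * \int[mu]_x (breg (f x) m (expR t))%:E)%E.
    rewrite -ge0_integralZl_EFin ?expR_ge0 //.
    by move=> x _; rewrite lee_fin breg_ge0 ?expR_gt0.
  have -> : (\sum_(i : I) \int[P]_w (Q i t w)%:E =
      (expR (beta * t))%:E * \sum_(i : I) \int[P]_w (q i w t)%:E)%E.
    rewrite ge0_sume_distrr; last first.
      by move=> i _; apply: integral_ge0 => w _; rewrite lee_fin mulr_lnB_ge0 ?expR_gt0.
    apply: eq_bigr => i _; rewrite -ge0_integralZl_EFin ?expR_ge0 //.
    by move=> w _; rewrite lee_fin mulr_lnB_ge0 ?expR_gt0.
  by rewrite muleCA (muleCA 2^-1%:E) lee_wpmul2l ?lee_fin ?expR_ge0 //; exact: H.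
(* [D] is the divergence averaged over the shifts. Its linear term has mean zero under [mu], so its
   mean is [G] times the left side of Beckner's inequality. *)
pose D x := G * (f x `^ p - m `^ p) - F * m `^ beta * (f x - m).
have IJ x : (\int[leb]_t (J t x)%:E = (D x)%:E)%E by rewrite IG // pE.
have D0 x : 0 <= D x.
  by rewrite -lee_fin -IJ; apply: integral_ge0 => t _; rewrite lee_fin.
pose B i w := (f (X w) - f (Xi X X' i w)) * (f (X w) `^ beta - f (Xi X X' i w) `^ beta).
have IQ i w : (\int[leb]_t (Q i t w)%:E = (F * B i w)%:E)%E.
  by rewrite /Q /q /B; exact: lnB_increment_integral.
have sumQ_ge0 t : (0 <= \sum_(i : I) \int[P]_w (Q i t w)%:E)%E.
  by apply: sume_ge0 => i _; apply: integral_ge0 => w _; rewrite lee_fin.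
have main : (rho0%:E * \int[mu]_x (D x)%:E <= F%:E * (glauber_form P X X' f (fun x => f x `^ beta))%:E)%E.
  have -> : (F%:E * (glauber_form P X X' f (fun x => f x `^ beta))%:E =
      \int[leb]_t (2^-1%:E * \sum_(i : I) \int[P]_w (Q i t w)%:E))%E.
    rewrite (EFin_glauber_form mX mX' Df Dfp) muleCA.
    rewrite ge0_integralZl_EFin //; last by apply: emeasurable_sum => i; exact: (TQ i).1.
    rewrite ge0_integral_sum //; last 2 first.
      by move=> i; exact: (TQ i).1.
      by move=> i t _; apply: integral_ge0 => w _; rewrite lee_fin.
    congr (_ * _)%E; rewrite ge0_sume_distrr; last first.
      by move=> i _; apply: integral_ge0 => w _; rewrite lee_fin powR_increment_ge0 // ltW.
    apply: eq_bigr => i _; rewrite (TQ i).2; under [RHS]eq_integral do rewrite IQ EFinM.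
    rewrite ge0_integralZl_EFin ?(ltW F0) //.
    - by move=> w _; rewrite lee_fin powR_increment_ge0 // ltW.
    - apply/measurable_EFinP; apply: measurable_funM; first exact: measurable_increment.
      exact: (@measurable_increment _ _ _ _ _ _ _ _ mX mX' (fun x => f x `^ beta) i Dfp.1).
  have -> : (\int[mu]_x (D x)%:E = \int[leb]_t \int[mu]_x (J t x)%:E)%E.
    by rewrite TJ; apply: eq_integral => x _; rewrite IJ.
  rewrite -ge0_integralZl_EFin ?(ltW rho0_gt0) //; last first.
    by move=> t _; apply: integral_ge0 => x _; rewrite lee_fin.
  apply: ge0_le_integral => //.
  - by move=> t _; rewrite mule_ge0 ?lee_fin ?(ltW rho0_gt0) // integral_ge0 // => x _; rewrite lee_fin.
  - exact: measurable_funeM.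
  - by apply: measurable_funeM; apply: emeasurable_sum => i; exact: (TQ i).1.
have mfp : measurable_fun setT (fun x => f x `^ p) by exact: (measurableT_comp (measurable_powR p) mf).
have mD : measurable_fun setT D.
  apply: measurable_funB; first by apply: measurable_funM => //; exact: measurable_funB.
  by apply: measurable_funM => //; exact: measurable_funB.
(* The right side of [main] is a real number and [rho0 > 0], so the nonnegative [D] has a finite
   integral. *)
have iD : mu.-integrable setT (EFin \o D).
  apply/integrableP; split; first exact/measurable_EFinP.
  under eq_integral do rewrite /= ger0_norm //.
  rewrite ltNge leye_eq; apply/negP => /eqP Doo; move: main.
  by rewrite Doo gt0_muley ?lte_fin // -EFinM leye_eq.
have icst c : mu.-integrable setT (EFin \o cst c) by exact: finite_measure_integrable_cst.
have ifm : mu.-integrable setT (EFin \o (fun x => f x - m)).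
  by apply: (@integrableB _ _ _ mu setT measurableT (EFin \o f) (EFin \o cst m)).
have iFfm : mu.-integrable setT (EFin \o (fun x => F * m `^ beta * (f x - m))).
  exact: (@integrableZl _ _ _ mu setT measurableT (F * m `^ beta) (EFin \o (fun x => f x - m))).
have iDF : mu.-integrable setT (EFin \o (fun x => D x + F * m `^ beta * (f x - m))).
  exact: (@integrableD _ _ _ mu setT measurableT (EFin \o D)
    (EFin \o (fun x => F * m `^ beta * (f x - m)))).
have iGDF : mu.-integrable setT (EFin \o (fun x => G^-1 * (D x + F * m `^ beta * (f x - m)))).
  exact: (@integrableZl _ _ _ mu setT measurableT G^-1
    (EFin \o (fun x => D x + F * m `^ beta * (f x - m)))).
(* Solving the definition of [D] for [f^p] transfers integrability from [D] and [f] to [f^p]; this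
   is where [G > 0] enters. *)
have fpE x : f x `^ p = G^-1 * (D x + F * m `^ beta * (f x - m)) + m `^ p.
  by rewrite /D; field; rewrite gt_eqF.
have ifp : mu.-integrable setT (EFin \o (fun x => f x `^ p)).
  under [X in integrable _ _ (_ \o X)]eq_fun do rewrite fpE.
  exact: (@integrableD _ _ _ mu setT measurableT
    (EFin \o (fun x => G^-1 * (D x + F * m `^ beta * (f x - m)))) (EFin \o cst (m `^ p))).
split => //.
have Ics c : \int[mu]_x (cst c x) = c.
  exact: Rintegral_probability_cst.
have ID : \int[mu]_x D x = G * (\int[mu]_x (f x `^ p) - m `^ p).
  under [in RHS]eq_Rintegral do rewrite fpE.
  rewrite (@RintegralD _ _ _ mu setT (fun x => G^-1 * (D x + F * m `^ beta * (f x - m)))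
    (cst (m `^ p))) // Ics.
  rewrite (@RintegralZl _ _ _ mu setT (fun x => D x + F * m `^ beta * (f x - m)) G^-1) //.
  rewrite (@RintegralD _ _ _ mu setT D (fun x => F * m `^ beta * (f x - m))) //.
  rewrite (@RintegralZl _ _ _ mu setT (fun x => f x - m) (F * m `^ beta)) //.
  rewrite (@RintegralB _ _ _ mu setT f (cst m)) // Ics -/m subrr mulr0 addr0.
  by rewrite addrK mulrA divff ?gt_eqF // mul1r.
have main' : rho0 * (G * (\int[mu]_x (f x `^ p) - m `^ p)) <=
    F * glauber_form P X X' f (fun x => f x `^ beta).
  rewrite -lee_fin -ID (EFinM F); apply: le_trans main.
  rewrite EFinM; rewrite le_eqVlt; apply/orP; left; apply/eqP; congr (_ * _)%E.
  by rewrite fineK //; exact: integrable_fin_num.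
have gf0 : 0 <= glauber_form P X X' f (fun x => f x `^ beta).
  rewrite mulr_ge0 // sumr_ge0 // => i _; apply: Rintegral_ge0 => w _.
  by rewrite powR_increment_ge0 // ltW.
rewrite -/m -/beta; set A := _ - _; set g := glauber_form _ _ _ _ _.
rewrite -/A -/g in main' gf0.
(* [F <= 3 * G] and division by [G]. The conclusion then follows from [g / 2 <= p / 2 * g], as
   [g >= 0] and [p > 1]. *)
have : rho0 * A <= 3 * g.
  rewrite -(ler_pM2r G0) -mulrA (mulrC A); apply: le_trans main' _.
  by rewrite mulrAC ler_wpM2r.
nra.
Qed.

End mlsi_beckner.

Section mlsi_poincare.
Context (R : realType) (I : finType) (dE : measure_display)
  (E : measurableType dE) (mu : probability (power I E) R)
  (dO : measure_display) (Omega : measurableType dO)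
  (P : probability Omega R) (X : Omega -> power I E) (X' : I -> Omega -> E).
Hypotheses (mX : measurable_fun setT X) (mX' : forall i, measurable_fun setT (X' i)).
Variables (rho0 : R) (rho0_gt0 : 0 < rho0).
Hypothesis mlsi : modified_log_sobolev mu P X X' rho0.
Implicit Types f g h : power I E -> R.

(** For large [s] the divergence is of order [(f - m)^2 / s], and [s] times the logarithmic energy
    is at most the quadratic one, so [s] cancels. The lower bound is effective only where [f + m] is
    at most of order [s]; hence the restriction to [A n], removed by monotone convergence. *)
Lemma mlsi_poincare_ge0 f : (forall x, 0 <= f x) -> in_Dom P X X' f ->
  mu.-integrable setT (EFin \o f) /\
  (\int[mu]_x ((f x - (\int[mu]_x f x)%R) ^+ 2)%:E <=
     (6 / rho0 * glauber_form P X X' f f)%:E)%E.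
Proof.
move=> f0 Df; have [mf _] := Df.
have [if_ _] := mlsi_breg mX mX' mlsi f0 Df ltr01.
split => //; set m := (\int[mu]_x f x)%R.
have m0 : 0 <= m by apply: Rintegral_ge0.
have mfm2 : measurable_fun setT (fun x => ((f x - m) ^+ 2)%:E).
  by apply/measurable_EFinP; apply: measurable_funX; exact: measurable_funB.
(* On [A n] the divergence at [s = n.+1] is at least [(f x - m)^2 / (6 * s)]. *)
pose A n := [set x | f x + m <= n.+1%:R].
have mA n : measurable (A n).
  rewrite -[A n]setTI.
  apply: (@measurable_fun_le _ _ _ setT (fun x => f x + m) (fun=> n.+1%:R)) => //.
  exact: measurable_funD.
have AE : \bigcup_n A n = setT.
  apply/seteqP; split => // x _.
  exists (Num.truncn (f x + m)) => //=; rewrite /A /=.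
  by apply/ltW; have := truncnS_gt (f x + m).
have ndA : nondecreasing_seq A.
  move=> n k nk; apply/subsetPset => x; rewrite /A /= => /le_trans; apply.
  by rewrite ler_nat ltnS.
have bound n : (\int[mu]_(x in A n) ((f x - m) ^+ 2)%:E <=
     (6 / rho0 * glauber_form P X X' f f)%:E)%E.
  set s : R := n.+1%:R; have s0 : 0 < s by rewrite ltr0n.
  have [_ H] := mlsi_breg mX mX' mlsi f0 Df s0.
  have mb : measurable_fun setT (fun x => (breg (f x) m s)%:E).
    rewrite /breg; apply/measurable_EFinP; apply: measurable_funB; last exact: measurable_funB.
    apply: measurable_funM; first exact: measurable_funD.
    by apply: measurable_funB => //; apply: measurableT_comp => //; exact: measurable_funD.
  apply: (@le_trans _ _ (\int[mu]_x ((6 * s)%:E * (breg (f x) m s)%:E))%E).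
    apply: (@le_trans _ _ (\int[mu]_(x in A n) ((6 * s)%:E * (breg (f x) m s)%:E))%E).
      apply: ge0_le_integral => //.
      - by move=> x _; rewrite lee_fin sqr_ge0.
      - exact: measurable_funTS.
      - by apply: measurable_funTS; exact: measurable_funeM.
      - move=> x; rewrite /A /= -/s => Ax; rewrite -EFinM lee_fin.
        apply: (@le_trans _ _ (6 * s * ((f x - m) ^+ 2 / (2 * (f x + m + 2 * s))))); last first.
          by rewrite ler_pM2l ?breg_ge // mulr_gt0.
        rewrite mulrCA ler_peMr ?sqr_ge0 // ler_pdivlMr; have := f0 x; lra.
    apply: ge0_subset_integral => //; first exact: measurable_funeM.
    by move=> x _; rewrite mule_ge0 ?lee_fin ?breg_ge0 // mulr_ge0 // ltW.
  rewrite ge0_integralZl_EFin ?mulr_ge0 ?(ltW s0) //; last first.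
    by move=> x _; rewrite lee_fin breg_ge0.
  rewrite (_ : (6 * s)%:E = (6 / rho0 * s)%:E * rho0%:E)%E; last first.
    by rewrite -EFinM; congr EFin; field; rewrite gt_eqF.
  rewrite -muleA.
  have c0 : 0 <= 6 / rho0 * s by rewrite !mulr_ge0 ?invr_ge0 ?ltW.
  apply: le_trans (lee_wpmul2l _ H) _; first by rewrite lee_fin.
  rewrite (EFinM (6 / rho0) s) (EFinM (6 / rho0)) -muleA lee_wpmul2l ?lee_fin ?divr_ge0 ?(ltW rho0_gt0) //.
  rewrite (EFin_glauber_form mX mX' Df Df) muleCA lee_wpmul2l ?lee_fin //.
  rewrite ge0_sume_distrr; last first.
    by move=> i _; apply: integral_ge0 => w _; rewrite lee_fin mulr_lnB_ge0.
  apply: lee_sum => i _.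
  have mq : measurable_fun setT (fun w => ((f (X w) - f (Xi X X' i w)) *
        (ln (f (X w) + s) - ln (f (Xi X X' i w) + s)))%:E).
    apply/measurable_EFinP; apply: measurable_funM; first exact: measurable_increment.
    apply: (@measurable_increment _ _ _ _ _ _ _ _ mX mX' (fun x => ln (f x + s)) i).
    by apply: measurableT_comp => //; exact: measurable_funD.
  rewrite -ge0_integralZl_EFin ?(ltW s0) //; last first.
    by move=> w _; rewrite lee_fin mulr_lnB_ge0.
  apply: ge0_le_integral => //.
  - by move=> w _; rewrite -EFinM lee_fin mulr_ge0 ?mulr_lnB_ge0 // ltW.
  - exact: measurable_funeM.
  - by apply/measurable_EFinP/measurable_funM; exact: measurable_increment.
  - by move=> w _; rewrite -EFinM lee_fin -expr2; exact: mulr_lnB_le.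
rewrite -AE.
apply: (@cvge_to_le _ \oo _ _ (fun n => \int[mu]_(x in A n) ((f x - m) ^+ 2)%:E)%E);
  last by apply: nearW; exact: bound.
apply: ge0_nondecreasing_set_cvg_integral => //.
  by move=> n; exact: measurable_funTS.
by move=> n x _; rewrite lee_fin sqr_ge0.
Qed.

Lemma mlsi_beckner2 : beckner mu P X X' 2 (rho0 / 6).
Proof.
move=> f f0 Df _; have [mf _] := Df.
have [if_ pc] := mlsi_poincare_ge0 f0 Df.
set m := \int[mu]_x f x in pc *.
have icst c : mu.-integrable setT (EFin \o cst c) by exact: finite_measure_integrable_cst.
have Ics c : \int[mu]_x (cst c x) = c.
  exact: Rintegral_probability_cst.
have i2 : mu.-integrable setT (EFin \o (fun x => (f x - m) ^+ 2)).
  apply/integrableP; split.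
    by apply/measurable_EFinP; apply: measurable_funX; exact: measurable_funB.
  under eq_integral do rewrite /= ger0_norm ?sqr_ge0 //.
  by rewrite (le_lt_trans pc) ?ltry.
have imf : mu.-integrable setT (EFin \o (fun x => 2 * m * f x)).
  exact: (@integrableZl _ _ _ mu setT measurableT (2 * m) (EFin \o f)).
have imf' : mu.-integrable setT (EFin \o (fun x => 2 * m * f x - m ^+ 2)).
  exact: (@integrableB _ _ _ mu setT measurableT (EFin \o (fun x => 2 * m * f x)) (EFin \o cst (m ^+ 2))).
(* Integrability of [f^2] is deduced from that of [(f - m)^2], the quantity that the Poincare
   inequality controls. *)
have f2E x : f x `^ 2 = (f x - m) ^+ 2 + (2 * m * f x - m ^+ 2).
  by rewrite powR_mulrn //; ring.
split => //.
  under [X in integrable _ _ X]eq_fun do rewrite f2E.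
  exact: (@integrableD _ _ _ mu setT measurableT (EFin \o (fun x => (f x - m) ^+ 2))
    (EFin \o (fun x => 2 * m * f x - m ^+ 2))).
under eq_Rintegral do rewrite f2E.
rewrite (@RintegralD _ _ _ mu setT (fun x => (f x - m) ^+ 2)) //.
rewrite (@RintegralB _ _ _ mu setT (fun x => 2 * m * f x) (cst (m ^+ 2))) // Ics.
rewrite (@RintegralZl _ _ _ mu setT f (2 * m)) // -/m.
have m0 : 0 <= m by apply: Rintegral_ge0.
rewrite (powR_mulrn 2 m0) divff // mul1r.
have -> : (fun x => f x `^ (2 - 1)) = f.
  by apply/funext => x; rewrite (_ : 2 - 1 = 1 :> R) ?powRr1 //; lra.
have : \int[mu]_x ((f x - m) ^+ 2) <= 6 / rho0 * glauber_form P X X' f f.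
  by rewrite -lee_fin; apply: le_trans pc; rewrite fineK //; exact: integrable_fin_num.
rewrite -(ler_pM2l (_ : 0 < rho0 / 6)) ?divr_gt0 // mulrA.
have -> : rho0 / 6 * (6 / rho0) = 1 by field; rewrite gt_eqF.
by rewrite mul1r; apply: le_trans; rewrite ler_pM2l ?divr_gt0 //; lra.
Qed.

Lemma mlsi_beckner p : 1 < p <= 2 -> beckner mu P X X' p (rho0 / 6).
Proof.
case/andP=> p1; rewrite le_eqVlt => /predU1P[->|p2]; first exact: mlsi_beckner2.
by apply: (mlsi_beckner_lt2 mX mX' rho0_gt0 mlsi); rewrite p1.
Qed.

End mlsi_poincare.

(** * Exchangeability *)

Section weighted_integrals.
Import HBNNSimple.
Context d (T : measurableType d) (R : realType) (m : {measure set T -> \bar R})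
  d' (S : measurableType d') (phi : T -> S).
Hypothesis mphi : measurable_fun setT phi.
Local Open Scope ereal_scope.

Let integral_weight_nnsfun (u : T -> \bar R) (g : {nnsfun S >-> R}) :
  measurable_fun setT u -> (forall x, 0 <= u x) ->
  \int[m]_x (u x * (g (phi x))%:E) =
  \sum_(r \in range g) (r%:E * \int[m]_(x in phi @^-1` (g @^-1` [set r])) u x).
Proof.
move=> mu_ u0.
have mpre r : measurable (phi @^-1` (g @^-1` [set r])).
  by rewrite -[X in measurable X]setTI; exact: mphi.
transitivity (\int[m]_x \sum_(r \in range g)
    (r%:E * (u x * (\1_(phi @^-1` (g @^-1` [set r])) x)%:E))).
  apply: eq_integral => x _; rewrite fimfunE -fsumEFin // ge0_mule_fsumr; last first.
    by move=> r; rewrite EFinM nnfun_muleindic_ge0.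
  by apply: eq_fsbigr => r _; rewrite EFinM muleCA.
rewrite ge0_integral_fsum //; last 2 first.
- move=> r; apply: measurable_funeM; apply: emeasurable_funM => //.
  exact/measurable_EFinP/measurable_indic.
- move=> r x _; rewrite muleCA mule_ge0 //.
  exact: (nnfun_muleindic_ge0 g r (phi x)).
apply: eq_fsbigr => r; rewrite inE => -[y _ <-{r}].
rewrite ge0_integralZl //; last 3 first.
- apply: emeasurable_funM => //; exact/measurable_EFinP/measurable_indic.
- by move=> x _; rewrite mule_ge0 // lee_fin.
- by rewrite lee_fin.
congr (_ * _); rewrite [RHS]integral_mkcond.
by apply: eq_integral => x _; rewrite epatch_indic.
Qed.

(** The hypothesis is the case of an indicator [h]; simple functions follow by linearity and the
    general case by monotone limits. Applied to the projection [restr i] it handles conditional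
    distributions, applied to the identity towards the sigma-algebra of [X] it handles conditional
    expectations. *)
Lemma integral_weight_eq (u v : T -> \bar R) (h : S -> \bar R) :
  measurable_fun setT u -> measurable_fun setT v -> measurable_fun setT h ->
  (forall x, 0 <= u x) -> (forall x, 0 <= v x) -> (forall y, 0 <= h y) ->
  (forall A, measurable A ->
     \int[m]_(x in phi @^-1` A) u x = \int[m]_(x in phi @^-1` A) v x) ->
  \int[m]_x (u x * h (phi x)) = \int[m]_x (v x * h (phi x)).
Proof.
move=> mu_ mv mh u0 v0 h0 uv.
pose g := nnsfun_approx measurableT mh.
have cvgg y : (g n y)%:E @[n --> \oo] --> h y.
  by apply: cvg_nnsfun_approx.
have ndg y : {homo (fun n => g n y) : a b / (a <= b)%N >-> (a <= b)%R}.
  by move=> a b ab; exact/lefP/nd_nnsfun_approx.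
have lim (w : T -> \bar R) : measurable_fun setT w -> (forall x, 0 <= w x) ->
    \int[m]_x (w x * h (phi x)) = limn (fun n => \int[m]_x (w x * (g n (phi x))%:E)).
  move=> mw w0; rewrite -monotone_convergence //; last 3 first.
  - move=> n; apply: emeasurable_funM => //; apply/measurable_EFinP.
    exact: measurableT_comp.
  - by move=> n x _; rewrite mule_ge0 // lee_fin.
  - by move=> x _ a b ab; rewrite lee_wpmul2l // lee_fin ndg.
  apply: eq_integral => x _; apply/esym/cvg_lim => //.
  have := w0 x; case: (w x) => [r r0|_|//].
    by apply: cvgeZl.
  (* Where the weight is [+oo], the product is 0 as long as the approximations vanish, and [+oo]
     from the first positive one on; in both cases this is the product with the limit. *)
  have [[N gN]|g0] := pselect (exists N, (0 < g N (phi x))%R); last first.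
    have gE : (fun n => (g n (phi x))%:E) = cst 0.
      apply/funext => n; apply/eqP; rewrite eqe eq_le fun_ge0 andbT leNgt.
      by apply/negP => gn0; apply: g0; exists n.
    have h0' : h (phi x) = 0.
      by apply/esym/(cvg_unique _ _ (cvgg (phi x))) => //; rewrite gE; exact: cvg_cst.
    rewrite h0' mule0 (_ : (fun n => _) = cst 0); first exact: cvg_cst.
    by apply/funext => n; have := congr1 (fun k => k n) gE => /= ->; rewrite mule0.
  have hN : (g N (phi x))%:E <= h (phi x).
    by apply: (cvge_to_ge (cvgg (phi x))); exists N => // n /= Nn; rewrite lee_fin ndg.
  rewrite gt0_mulye ?(lt_le_trans _ hN) ?lte_fin //.
  apply: cvg_near_cst; exists N => // n /= Nn.
  by rewrite gt0_mulye // lte_fin (lt_le_trans gN) // ndg.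
rewrite (lim u) // (lim v) //; congr (limn _); apply/funext => n.
rewrite !integral_weight_nnsfun //; apply: eq_fsbigr => r _.
by rewrite uv.
Qed.

End weighted_integrals.

Section exchangeability.
Context (R : realType) (I : finType) (dE : measure_display)
  (E : measurableType dE) (mu : probability (power I E) R) (i : I)
  (k : R.-pker (power (others i) E) ~> E).
Hypothesis k_cond : is_cond_distribution mu k.
Context (dO : measure_display) (Omega : measurableType dO)
  (P : probability Omega R) (X : Omega -> power I E) (X' : I -> Omega -> E).
Hypotheses (mX : measurable_fun setT X) (mX' : measurable_fun setT (X' i)).
Hypothesis X'_law : is_resampled_coordinate mu k P X (X' i).

(** A product set for the splitting of the index set into [others i] and [i], kept inside
    [power I E] so that no isomorphism with a binary product has to be built. *)
Definition rect (A : set (power (others i) E)) (B : set E) : set (power I E) :=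
  [set x | A (restr i x) /\ B (x i)].

Lemma measurable_rect A B : measurable A -> measurable B -> measurable (rect A B).
Proof.
move=> mA mB.
have -> : rect A B = (restr i @^-1` A) `&` ((fun x : power I E => x i) @^-1` B) by [].
apply: measurableI; rewrite -[X in measurable X]setTI.
- exact: (measurable_restr i measurableT A mA).
- exact: (measurable_coord i measurableT B mB).
Qed.

(** Given the other coordinates, [X_i] and [X'_i] are independent with the same law [k]. The law of
    [X'_i] supplies the factor for [C]; [k_cond] replaces the indicator of [x i] in [B] by
    [k (restr i x) B]. The result is symmetric in [B] and [C], which is what exchangeability rests
    on. *)
Lemma rect_resample_law A B C : measurable A -> measurable B -> measurable C ->
  (P (X @^-1` rect A B `&` X' i @^-1` C) =
   \int[mu]_x (k (restr i x) B * (k (restr i x) C * (\1_A (restr i x))%:E)))%E.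
Proof.
move=> mA mB mC; rewrite X'_law //; last exact: measurable_rect.
have mk D : measurable D -> measurable_fun setT (fun y => k y D).
  by move=> mD; exact: measurable_kernel.
have mBi : measurable ((fun x : power I E => x i) @^-1` B).
  by rewrite -[X in measurable X]setTI; exact: (measurable_coord i measurableT B mB).
transitivity (\int[mu]_x ((\1_((fun x : power I E => x i) @^-1` B) x)%:E *
    (k (restr i x) C * (\1_A (restr i x))%:E)))%E.
  rewrite integral_mkcond; apply: eq_integral => x _.
  rewrite epatch_indic muleCA; congr (_ * _)%E; rewrite -EFinM; congr EFin.
  rewrite /rect !indicE -natrM mulnb; congr (_%:R); congr nat_of_bool.
  by rewrite andbC; apply/idP/andP => [|[]]; rewrite !inE.
apply: (integral_weight_eq (measurable_restr i) (m := mu)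
  (h := fun y => k y C * (\1_A y)%:E)%E) => //.
- by apply/measurable_EFinP; exact: measurable_indic.
- exact: (measurableT_comp (mk _ mB) (measurable_restr i)).
- apply: emeasurable_funM; first exact: mk.
  by apply/measurable_EFinP; exact: measurable_indic.
- move=> A' mA'; rewrite -k_cond // integral_indic //; last first.
    by rewrite -[X in measurable X]setTI; exact: (measurable_restr i measurableT A' mA').
  by congr (mu _); apply/seteqP; split => x [].
Qed.

(** A cylinder constrains a single coordinate, which is either [i] or one of the others; the
    remaining side of the rectangle is the whole space. *)
Lemma rect_cylinder (A : set (power I E)) : cylinders A ->
  exists2 BC, measurable BC.1 /\ measurable BC.2 & A = rect BC.1 BC.2.
Proof.
case=> j _ [B mB <-]; rewrite setTI; have [ji|ji] := eqVneq j i.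
  exists (setT, B) => /=; first by split.
  by apply/seteqP; split => x; rewrite /rect /= ji; tauto.
exists ((fun x : power (others i) E => x (Sub j ji)) @^-1` B, setT).
  split => //=; rewrite -[X in measurable X]setTI.
  exact: (measurable_coord (Sub j ji : others i) measurableT B mB).
by apply/seteqP; split => x; rewrite /rect /restr /= ?SubK; tauto.
Qed.

Lemma resampling_exchangeable (F : power I E * power I E -> \bar R) :
  measurable_fun setT F -> (forall z, 0 <= F z)%E ->
  (\int[P]_w F (X w, Xi X X' i w) = \int[P]_w F (Xi X X' i w, X w))%E.
Proof.
move=> mF F0.
have mXi : measurable_fun setT (Xi X X' i) by exact: measurable_Xi.
have m1 : measurable_fun setT (fun w => (X w, Xi X X' i w)) by exact: measurable_fun_pair.
have m2 : measurable_fun setT (fun w => (Xi X X' i w, X w)) by exact: measurable_fun_pair.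
transitivity (\int[pushforward P (fun w => (X w, Xi X X' i w))]_z F z)%E.
  by rewrite ge0_integral_pushforward.
transitivity (\int[pushforward P (fun w => (Xi X X' i w, X w))]_z F z)%E; last first.
  by rewrite ge0_integral_pushforward.
apply: eq_measure_integral => A mA _.
(* Products of two rectangles are stable under intersection and generate the product sigma-algebra,
   so it is enough to compare the two laws on them. *)
pose G : set (set (power I E * power I E)) :=
  [set Z | exists Q : set (power (others i) E) * set E * (set (power (others i) E) * set E),
    [/\ measurable Q.1.1, measurable Q.1.2, measurable Q.2.1, measurable Q.2.2 &
        Z = rect Q.1.1 Q.1.2 `*` rect Q.2.1 Q.2.2]].
have rectT : rect setT setT = setT by apply/seteqP; split.
have GT : G setT.
  exists (setT, setT, (setT, setT)); split => //=.
  by rewrite rectT; apply/seteqP; split.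
have restrXi w : restr i (Xi X X' i w) = restr i (X w).
  by apply/funext => j; rewrite /restr /Xi /resample (negPf (valP j)).
have Xii w : Xi X X' i w i = X' i w by rewrite /Xi /resample eqxx.
apply: (@g_sigma_algebra_measure_unique _ R _ G _ (fun=> setT)) => //.
- move=> _ [[[A1 B1] [A2 B2]]] /= [? ? ? ? ->].
  by apply: measurableX; exact: measurable_rect.
- by apply/seteqP; split => // x _; exists 0%N.
- move=> _ _ [[[A1 B1] [A2 B2]]] /= [? ? ? ? ->] [[[A3 B3] [A4 B4]]] /= [? ? ? ? ->].
  exists (A1 `&` A3, B1 `&` B3, (A2 `&` A4, B2 `&` B4)) => /=; split; try exact: measurableI.
  by apply/seteqP; split => -[x y] /=; rewrite /rect /=; tauto.
- move=> _ [[[A1 B1] [A2 B2]]] /= [mA1 mB1 mA2 mB2 ->].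
  rewrite /pushforward.
  (* [X] and [X^i] share all coordinates but [i], so the two constraints on the others merge into
     [A1 & A2]. Swapping the pair exchanges [B1] and [B2], under which [rect_resample_law] is
     symmetric. *)
  transitivity (P (X @^-1` rect (A1 `&` A2) B1 `&` X' i @^-1` B2)).
    congr (P _); apply/seteqP; split => w /=; rewrite /rect /= restrXi Xii; tauto.
  transitivity (P (X @^-1` rect (A1 `&` A2) B2 `&` X' i @^-1` B1)); last first.
    congr (P _); apply/seteqP; split => w /=; rewrite /rect /= restrXi Xii; tauto.
  rewrite !rect_resample_law //; try exact: measurableI.
  by apply: eq_integral => x _; rewrite muleCA.
- move=> _; apply: (@le_lt_trans _ _ 1%E); last exact: ltry.
  by apply: probability_le1; rewrite preimage_setT.
(* For generation: cylinders in either factor lie in [G], hence both projections, and so the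
   identity, are measurable from the sigma-algebra generated by [G]. *)
have cylG Q B : (exists j, exists2 C, measurable C & Q = (fun x : power I E => x j) @^-1` C) ->
    (B = Q `*` setT \/ B = setT `*` Q) -> G B.
  move=> [j [C mC QE]]; have [|[Q1 Q2] [/= ? ?] ->] := @rect_cylinder Q.
    by exists j => //; exists C; rewrite // QE setTI.
  rewrite -rectT; case=> ->.
  - by exists (Q1, Q2, (setT, setT)); split => //=.
  - by exists (setT, setT, (Q1, Q2)); split => //=.
have mfst : measurable_fun setT (fun z : g_sigma_algebraType G => z.1 : power I E).
  apply: measurable_fun_power => j _ C mC; rewrite setTI.
  apply: sub_sigma_algebra; apply: (cylG ((fun x : power I E => x j) @^-1` C)).
    by exists j, C.
  by left; apply/seteqP; split => z //= [].
have msnd : measurable_fun setT (fun z : g_sigma_algebraType G => z.2 : power I E).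
  apply: measurable_fun_power => j _ C mC; rewrite setTI.
  apply: sub_sigma_algebra; apply: (cylG ((fun x : power I E => x j) @^-1` C)).
    by exists j, C.
  by right; apply/seteqP; split => z //= [].
have := measurable_fun_pair mfst msnd measurableT mA; rewrite setTI.
rewrite (_ : _ @^-1` A = A) //.
by apply/seteqP; split => -[].
Qed.

End exchangeability.

(** * Moments *)

Section powR_inequalities.
Context {R : realType}.
Implicit Types s t a b y : R.

Lemma invr_powR a s : 0 <= a -> a^-1 `^ s = (a `^ s)^-1.
Proof. by move=> a0; rewrite -powR_inv1 // -powRrM mulN1r powRN. Qed.

(** The convex function [y^s] lies above its tangent at [a]. It is Young's inequality with exponents
    [s / (s - 1)] and [s], whence the separate case [s = 1]. *)
Lemma powR_tangent s a b : 1 <= s -> 0 <= a -> 0 <= b ->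
  s * (a `^ (s - 1) * b) <= (s - 1) * a `^ s + b `^ s.
Proof.
rewrite le_eqVlt => /predU1P[<-|s1] a0 b0.
  by rewrite subrr powRr0 !mul1r mul0r add0r powRr1.
have s0 : 0 < s by lra.
have h := @conjugate_powR R (a `^ (s - 1)) b (s / (s - 1)) s (powR_ge0 _ _) b0.
have -> : (s - 1) * a `^ s + b `^ s =
    s * ((a `^ (s - 1)) `^ (s / (s - 1)) / (s / (s - 1)) + b `^ s / s).
  rewrite -powRrM (_ : (s - 1) * (s / (s - 1)) = s); last by field; lra.
  by field; rewrite !gt_eqF //; lra.
rewrite ler_pM2l //; apply: h => //; first by rewrite divr_gt0 //; lra.
by field; rewrite !gt_eqF //; lra.
Qed.

(** The concave function [z^(s/t)] at [z = y^t] lies below its tangent at 1. Integrated, it plays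
    the role of Jensen's inequality between moments. *)
Lemma powR_le_affine s t y : 0 < s -> s <= t -> 0 <= y ->
  y `^ s <= s / t * y `^ t + (1 - s / t).
Proof.
move=> s0 st y0; have t0 : 0 < t by apply: lt_le_trans st.
have ts : 1 <= t / s by rewrite ler_pdivlMr ?mul1r.
have := powR_tangent ts (@ler01 R) (powR_ge0 y s).
rewrite !powR1 mul1r mulr1 -powRrM (_ : s * (t / s) = t); last by field; lra.
rewrite -(ler_pM2l (divr_gt0 s0 t0)) mulrA (_ : s / t * (t / s) = 1); last by field; lra.
rewrite mul1r; move/le_trans; apply; rewrite le_eqVlt; apply/orP; left; apply/eqP.
by field; rewrite !gt_eqF.
Qed.

(** The tangent inequality at the larger argument. Of the two terms on the right one vanishes; both
    are written so that the bound is symmetric, and exchangeability gives them the same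
    expectation. *)
Lemma powR_increment_le s a b : 1 <= s -> 0 <= a -> 0 <= b ->
  (a `^ s - b `^ s) * (a - b) <=
  s * (a `^ (s - 1) * Num.max (a - b) 0 ^+ 2 + b `^ (s - 1) * Num.max (b - a) 0 ^+ 2).
Proof.
move=> s1 a0 b0; wlog ba : a b a0 b0 / b <= a.
  move=> W; have [/W ->//|/ltW ab] := leP b a.
  have -> : (a `^ s - b `^ s) * (a - b) = (b `^ s - a `^ s) * (b - a) by ring.
  by rewrite [X in s * X]addrC; exact: W.
rewrite max_l ?subr_ge0 // max_r ?subr_le0 // expr0n /= mulr0 addr0.
rewrite expr2 !mulrA ler_wpM2r ?subr_ge0 //.
have := powR_tangent s1 a0 b0; rewrite mulrA => h.
have ha : a `^ (s - 1) * a = a `^ s by rewrite mulrC mulr_powRB1 //; lra.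
by rewrite mulrBr -(mulrA _ _ a) ha; lra.
Qed.

End powR_inequalities.

Section bounded_functions.
Context (R : realType) (I : finType) (dE : measure_display)
  (E : measurableType dE) (mu : probability (power I E) R)
  (dO : measure_display) (Omega : measurableType dO)
  (P : probability Omega R) (X : Omega -> power I E) (X' : I -> Omega -> E).
Hypotheses (mX : measurable_fun setT X) (mX' : forall i, measurable_fun setT (X' i)).

Lemma in_Dom_bounded (h : power I E -> R) M : measurable_fun setT h -> (forall x, 0 <= h x <= M) ->
  in_Dom P X X' h.
Proof.
move=> mh hM; split => //; apply: lte_sum_pinfty => i _.
apply: (@le_lt_trans _ _ (\int[P]_w (M ^+ 2)%:E)%E).
  apply: ge0_le_integral => //.
  - by move=> w _; rewrite lee_fin sqr_ge0.
  - exact: measurable_increment_sqr.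
  - move=> w _; rewrite lee_fin; have := hM (X w); have := hM (Xi X X' i w).
    set a := h _; set b := h _ => /andP[a0 aM] /andP[b0 bM].
    by nra.
by rewrite integral_probability_cst ltry.
Qed.

End bounded_functions.

Lemma ge0_integral_law d1 (T1 : measurableType d1) d2 (T2 : measurableType d2) (R : realType)
    (m1 : {measure set T1 -> \bar R}) (m2 : {measure set T2 -> \bar R}) (X : T1 -> T2)
    (h : T2 -> \bar R) :
  measurable_fun setT X -> (forall A, measurable A -> m1 (X @^-1` A) = m2 A) ->
  measurable_fun setT h -> (forall x, 0 <= h x)%E ->
  (\int[m2]_x h x = \int[m1]_w h (X w))%E.
Proof.
move=> mX law mh h0.
transitivity (\int[pushforward m1 X]_x h x)%E; last by rewrite ge0_integral_pushforward.
by apply: eq_measure_integral => A mA _; rewrite -law.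
Qed.

Section moment_induction.
Context (R : realType) (I : finType) (dE : measure_display)
  (E : measurableType dE) (mu : probability (power I E) R)
  (dO : measure_display) (Omega : measurableType dO)
  (P : probability Omega R) (X : Omega -> power I E) (X' : I -> Omega -> E).
Hypotheses (mX : measurable_fun setT X) (mX' : forall i, measurable_fun setT (X' i)).
Hypothesis X_law : forall A, measurable A -> P (X @^-1` A) = mu A.
Hypothesis exch : forall i (F : power I E * power I E -> \bar R),
  measurable_fun setT F -> (forall z, 0 <= F z)%E ->
  (\int[P]_w F (X w, Xi X X' i w) = \int[P]_w F (Xi X X' i w, X w))%E.
Variables (alpha c B r M : R) (g : power I E -> R) (W : Omega -> \bar R).
Hypotheses (alpha0 : 0 < alpha) (c_def : 2 * alpha * c * (1 - expR (- 2^-1)) = 1).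
Hypothesis becks : forall p, 1 < p <= 2 -> beckner mu P X X' p alpha.
Hypotheses (mg : measurable_fun setT g) (g0 : forall x, 0 <= g x) (gM : forall x, g x <= M).
Hypotheses (mW : measurable_fun setT W) (W0 : forall w, (0 <= W w)%E).
Hypotheses (B0 : 0 < B) (r2 : 2 <= r).
Hypothesis W_le : (\int[P]_w (W w `^ (r / 2)) <= (B `^ (r / 2))%:E)%E.
Hypothesis energy_le : forall q, 2 <= q ->
  (\sum_(i : I) \int[P]_w (g (X w) `^ (q - 2) * Num.max (g (X w) - g (Xi X X' i w)) 0 ^+ 2)%:E
   <= \int[P]_w (W w * (g (X w) `^ (q - 2))%:E))%E.
Hypothesis base_le : (\int[mu]_x (g x ^+ 2)%:E <= (B / alpha)%:E)%E.

Let N q := \int[mu]_x (g x `^ q).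

(** By [c_def], [theta = 1 / (2 alpha c)]. It is both the gain in [(1 - 1/q)^(q/2) <= 1 - theta] and
    the weight of the energy term when moments are measured in units of [(c q B)^(q/2)]. *)
Let theta := 1 - expR (- 2^-1) : R.

Let theta0 : 0 < theta.
Proof. by rewrite subr_gt0 expR_lt1 oppr_lt0 invr_gt0. Qed.

Let theta_lt1 : theta < 1.
Proof. by rewrite /theta; have := expR_gt0 (- 2^-1 : R); lra. Qed.

Let theta2 : 2 * theta <= 1.
Proof. by rewrite /theta; have := @expR_ge1Dx R (- 2^-1); lra. Qed.

Let c0 : 0 < c.
Proof.
have : 0 < 2 * alpha * c * theta by rewrite c_def.
by rewrite pmulr_lgt0 // pmulr_rgt0 // mulr_gt0.
Qed.

(** From [e^(-1/2) >= 1/2] one has [2 * theta <= 1]. This makes the variance bound [B / alpha] at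
    most [c * q * B], as the base case requires. *)
Let c_alpha : 1 <= alpha * c.
Proof.
have -> : 1 = alpha * c * (2 * theta) by rewrite -[LHS]c_def /theta; ring.
by rewrite ler_piMr // mulr_ge0 // ltW.
Qed.

Let mgq q : measurable_fun setT (fun x => g x `^ q).
Proof. exact: (measurableT_comp (measurable_powR q) mg). Qed.

Let M0 : 0 <= M.
Proof. exact: le_trans (g0 point) (gM point). Qed.

Let gqM q x : 0 <= q -> 0 <= g x `^ q <= M `^ q.
Proof. by move=> q0; rewrite powR_ge0 ge0_ler_powR ?nnegrE. Qed.

Let igq q : 0 <= q -> mu.-integrable setT (EFin \o (fun x => g x `^ q)).
Proof.
by move=> q0; apply: (@integrable_probability_bounded _ _ _ mu _ (M `^ q)) => // x; exact: gqM.
Qed.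

Let NE q : 0 <= q -> (\int[P]_w (g (X w) `^ q)%:E = (N q)%:E)%E.
Proof.
move=> q0; rewrite /N fineK; last by exact: (integrable_fin_num measurableT (igq q0)).
apply/esym; apply: (ge0_integral_law (h := fun x => (g x `^ q)%:E) mX) => //.
- exact/measurable_EFinP.
- by move=> x; rewrite lee_fin powR_ge0.
Qed.

Let N_ge0 q : 0 <= N q.
Proof. by apply: Rintegral_ge0 => x _; exact: powR_ge0. Qed.

Let DomgQ q : 0 <= q -> in_Dom P X X' (fun x => g x `^ q).
Proof. by move=> q0; apply: (@in_Dom_bounded _ _ _ _ _ _ _ _ _ mX mX' _ (M `^ q)) => // x; exact: gqM. Qed.

(** With [s = q / 2], [t = r / 2], [y = g^2 / A] and [x = W / B], Young's inequality gives
    [s y^(s-1) x <= (s - 1) y^s + x^s]. As only the moment of order [t] of [W] is controlled, [x^s]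
    is bounded by [(s / t) x^t + 1 - s / t], whose integral is at most 1. The scale [A] is free and
    is fixed in [moment_step]. *)
Let energy_bound q A : 2 <= q -> q <= r -> 0 < A ->
  (\int[P]_w (W w * (g (X w) `^ (q - 2))%:E) <=
   (B * A `^ (q / 2 - 1) * (2 / q + (1 - 2 / q) * (N q / A `^ (q / 2))))%:E)%E.
Proof.
move=> q2 qr A0; set s := q / 2; set t := r / 2.
have s1 : 1 <= s by rewrite /s; lra.
have st : s <= t by rewrite /s /t; lra.
have t0 : 0 < t by lra.
have q0 : 0 <= q by lra.
have As0 : 0 < A `^ s by exact: powR_gt0.
have Bt0 : 0 < B `^ t by exact: powR_gt0.
pose K := B * A `^ (s - 1).
have K_gt0 : 0 < K by rewrite mulr_gt0 ?powR_gt0.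
have K0 := ltW K_gt0.
(* [k1], [k2], [k3] are the coefficients of [W^t], 1 and [g^q] once the two inequalities are
   combined and scaled back by [K / s]. *)
pose k1 := K / t / B `^ t.
pose k2 := K * (s^-1 - t^-1).
pose k3 := K * (1 - s^-1) / A `^ s.
have k10 : 0 < k1 by rewrite /k1; apply: divr_gt0 => //; apply: divr_gt0.
have k20 : 0 <= k2 by rewrite mulr_ge0 // subr_ge0 lef_pV2 ?posrE //; lra.
have k30 : 0 <= k3 by rewrite divr_ge0 ?powR_ge0 // mulr_ge0 // subr_ge0 invf_le1 //; lra.
have ptw w : (W w * (g (X w) `^ (q - 2))%:E <=
    k1%:E * W w `^ t + (k2 + k3 * g (X w) `^ q)%:E)%E.
  have := W0 w; case: (W w) => [v v0|_|//]; last first.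
    by rewrite poweRyr ?gt_eqF // gt0_muley ?lte_fin // addye // leey.
  rewrite poweR_EFin -!EFinM -EFinD lee_fin; rewrite lee_fin in v0.
  set u := g (X w); have u0 : 0 <= u by exact: g0.
  pose y := u ^+ 2 / A; pose x := v / B.
  have y0 : 0 <= y by rewrite divr_ge0 ?sqr_ge0 // ltW.
  have x0 : 0 <= x by rewrite divr_ge0 // ltW.
  have h1 := powR_tangent s1 y0 x0.
  have h2 : x `^ s <= s / t * x `^ t + (1 - s / t) by apply: powR_le_affine => //; lra.
  have uq z : (u ^+ 2) `^ z = u `^ (2 * z) by rewrite -powR_mulrn // -powRrM.
  have e1 : y `^ (s - 1) = u `^ (q - 2) / A `^ (s - 1).
    rewrite /y powRM ?sqr_ge0 ?invr_ge0 ?(ltW A0) // uq invr_powR ?(ltW A0) //.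
    by congr (_ `^ _ / _); rewrite /s; field.
  have e2 : y `^ s = u `^ q / A `^ s.
    rewrite /y powRM ?sqr_ge0 ?invr_ge0 ?(ltW A0) // uq invr_powR ?(ltW A0) //.
    by congr (_ `^ _ / _); rewrite /s; field.
  have e3 : x `^ t = v `^ t / B `^ t.
    by rewrite /x powRM ?invr_ge0 ?(ltW B0) // invr_powR ?(ltW B0).
  have As10 : 0 < A `^ (s - 1) by exact: powR_gt0.
  have -> : v * u `^ (q - 2) = K / s * (s * (y `^ (s - 1) * x)).
    by rewrite e1 /x /K; field; rewrite !gt_eqF //; lra.
  have -> : k1 * v `^ t + (k2 + k3 * u `^ q) =
      K / s * ((s - 1) * y `^ s + (s / t * x `^ t + (1 - s / t))).
    by rewrite e2 e3 /k1 /k2 /k3; field; rewrite !gt_eqF //; lra.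
  rewrite ler_wpM2l ?divr_ge0 //; lra.
have mWt : measurable_fun setT (fun w => W w `^ t)%E.
  exact: (measurableT_comp (measurable_poweR t) mW).
have mgX z : measurable_fun setT (fun w => (g (X w) `^ z)%:E).
  by apply/measurable_EFinP; exact: (measurableT_comp (mgq z) mX).
apply: (@le_trans _ _ (\int[P]_w (k1%:E * W w `^ t + (k2%:E + k3%:E * (g (X w) `^ q)%:E)))%E).
  apply: ge0_le_integral => //.
  - by move=> w _; rewrite mule_ge0 // lee_fin powR_ge0.
  - exact: emeasurable_funM.
  - apply: emeasurable_funD; first exact: measurable_funeM.
    by apply: emeasurable_funD => //; exact: measurable_funeM.
rewrite ge0_integralD //; last 4 first.
- by move=> w _; rewrite mule_ge0 ?poweR_ge0 // lee_fin ltW.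
- exact: measurable_funeM.
- by move=> w _; rewrite adde_ge0 ?mule_ge0 // lee_fin ?powR_ge0.
- by apply: emeasurable_funD => //; exact: measurable_funeM.
rewrite ge0_integralD //; last 2 first.
- by move=> w _; rewrite mule_ge0 // lee_fin powR_ge0.
- exact: measurable_funeM.
rewrite ge0_integralZl_EFin ?(ltW k10) //; last by move=> w _; rewrite poweR_ge0.
rewrite ge0_integralZl_EFin //; last by move=> w _; rewrite lee_fin powR_ge0.
rewrite integral_probability_cst NE //.
apply: (@le_trans _ _ (k1%:E * (B `^ t)%:E + (k2%:E + k3%:E * (N q)%:E))%E).
  by rewrite leeD2r // lee_wpmul2l // lee_fin ltW.
rewrite -!EFinM -!EFinD lee_fin /k1 /k2 /k3 -/K.
rewrite le_eqVlt; apply/orP; left; apply/eqP.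
have -> : 2 / q = s^-1 by rewrite /s invf_div.
by field; rewrite !gt_eqF //; lra.
Qed.

Let increment_powR_measurable q :
  measurable_fun setT (fun z : power I E * power I E =>
    (g z.1 `^ q * Num.max (g z.1 - g z.2) 0 ^+ 2)%:E).
Proof.
have mg1 : measurable_fun setT (fun z : power I E * power I E => g z.1).
  exact: (measurableT_comp mg measurable_fst).
have mg2 : measurable_fun setT (fun z : power I E * power I E => g z.2).
  exact: (measurableT_comp mg measurable_snd).
apply/measurable_EFinP; apply: measurable_funM.
  exact: (measurableT_comp (measurable_powR q) mg1).
apply: measurable_funX; apply: measurable_maxr => //.
exact: measurable_funB.
Qed.

(** [powR_increment_le] with exponent [q - 1] bounds each integrand by a term and its mirror image
    under the exchange of [X] and [X^i]. Their expectations agree, and the resulting 2 cancels the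
    1/2 of the form. *)
Let glauber_powR_le q Z : 2 <= q ->
  (\int[P]_w (W w * (g (X w) `^ (q - 2))%:E) <= Z%:E)%E ->
  glauber_form P X X' (fun x => g x `^ (q - 1)) g <= (q - 1) * Z.
Proof.
move=> q2 WZ; have q10 : 0 <= q - 1 by lra.
have q20 : 0 <= q - 2 by lra.
have Dg : in_Dom P X X' g.
  by apply: (in_Dom_bounded P mX mX' mg (M := M)) => x; rewrite g0 gM.
have Dgq : in_Dom P X X' (fun x => g x `^ (q - 1)) by exact: DomgQ.
rewrite -lee_fin (EFin_glauber_form mX mX' Dgq Dg).
have mXi i : measurable_fun setT (Xi X X' i) by exact: measurable_Xi.
pose H (z : power I E * power I E) : \bar R :=
  (g z.1 `^ (q - 2) * Num.max (g z.1 - g z.2) 0 ^+ 2)%:E.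
have H0 z : (0 <= H z)%E by rewrite lee_fin mulr_ge0 ?powR_ge0 ?sqr_ge0.
have mH : measurable_fun setT H by exact: increment_powR_measurable.
have mH1 i : measurable_fun setT (fun w => H (X w, Xi X X' i w)).
  by apply: (measurableT_comp mH); exact: measurable_fun_pair.
have mH2 i : measurable_fun setT (fun w => H (Xi X X' i w, X w)).
  by apply: (measurableT_comp mH); exact: measurable_fun_pair.
apply: (@le_trans _ _ (2^-1%:E * \sum_(i : I) (2 * (q - 1))%:E * \int[P]_w H (X w, Xi X X' i w))%E).
  rewrite lee_wpmul2l ?lee_fin ?invr_ge0 //; apply: lee_sum => i _.
  apply: (@le_trans _ _ (\int[P]_w ((q - 1)%:E * (H (X w, Xi X X' i w) + H (Xi X X' i w, X w))))%E).
    apply: ge0_le_integral => //.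
    - move=> w _; rewrite lee_fin.
      have [ba|/ltW ab] := leP (g (Xi X X' i w)) (g (X w)).
        by rewrite mulr_ge0 ?subr_ge0 // ge0_ler_powR ?nnegrE.
      by rewrite -mulrNN !opprB mulr_ge0 ?subr_ge0 // ge0_ler_powR ?nnegrE.
    - apply/measurable_EFinP; apply: measurable_funM; last exact: measurable_increment.
      exact: (@measurable_increment _ _ _ _ _ _ _ _ mX mX' (fun x => g x `^ (q - 1)) i (mgq _)).
    - by apply: measurable_funeM; apply: emeasurable_funD.
    - move=> w _; rewrite /H /= -EFinD -EFinM lee_fin.
      have := @powR_increment_le R (q - 1) (g (X w)) (g (Xi X X' i w)).
      by rewrite (_ : q - 1 - 1 = q - 2); [apply => //; lra|ring].
  rewrite ge0_integralZl_EFin //; last 2 first.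
  - by move=> w _; rewrite adde_ge0.
  - exact: emeasurable_funD.
  rewrite ge0_integralD // -(exch i mH H0) -mule2n -[(_ *+ 2)%E]mule_natl muleCA muleA.
  by rewrite -EFinM.
rewrite -ge0_sume_distrr; last by move=> i _; apply: integral_ge0 => w _; exact: H0.
rewrite muleA -EFinM (_ : 2^-1 * (2 * (q - 1)) = q - 1); last by field.
by rewrite EFinM lee_wpmul2l ?lee_fin //; apply: le_trans WZ; exact: energy_le.
Qed.

(** For [p = q / (q - 1)] the power [p - 1 = 1 / (q - 1)] turns [g^(q-1)] back into [g], and
    [q >= 2] is exactly [p <= 2]. The factor [q - 1] of the energy bound cancels against [p]. *)
Let beckner_bound q Z : 2 <= q ->
  (\int[P]_w (W w * (g (X w) `^ (q - 2))%:E) <= Z%:E)%E ->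
  N q <= N (q - 1) `^ (q / (q - 1)) + q / (2 * alpha) * Z.
Proof.
move=> q2 WZ; have q10 : 0 < q - 1 by lra.
have gE x : (g x `^ (q - 1)) `^ (q / (q - 1) - 1) = g x.
  by rewrite -powRrM (_ : (q - 1) * _ = 1) ?powRr1 //; field; lra.
have gpE x : (g x `^ (q - 1)) `^ (q / (q - 1)) = g x `^ q.
  by rewrite -powRrM; congr (_ `^ _); field; lra.
have p12 : 1 < q / (q - 1) <= 2.
  by rewrite ltr_pdivlMr // ler_pdivrMr //; apply/andP; split; lra.
have Dg : in_Dom P X X' g.
  by apply: (in_Dom_bounded P mX mX' mg (M := M)) => x; rewrite g0 gM.
have Dgq : in_Dom P X X' (fun x => g x `^ (q - 1)) by apply: DomgQ; exact: ltW.
have [||_ _] := becks p12 (f := fun x => g x `^ (q - 1)) _ Dgq.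
- by move=> x; exact: powR_ge0.
- by under eq_fun do rewrite gE.
under eq_Rintegral do rewrite gpE.
under [X in glauber_form _ _ _ _ X]eq_fun do rewrite gE.
rewrite -/(N q) -/(N (q - 1)) => h.
have hZ := glauber_powR_le q2 WZ.
rewrite -lerBlDl -(ler_pM2l alpha0); apply: le_trans h _.
have -> : alpha * (q / (2 * alpha) * Z) = q / (q - 1) / 2 * ((q - 1) * Z).
  by field; rewrite !gt_eqF //; lra.
by rewrite ler_wpM2l // !divr_ge0 //; lra.
Qed.

(* Dividing Beckner's bound by [A^(q/2)], [G = N q / A^(q/2)] satisfies
   [G <= 1 - theta + theta * (2 / q + (1 - 2 / q) * G)], since
   [(1 - 1/q)^(q/2) <= e^(-1/2) = 1 - theta]; this forces [G <= 1]. *)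
Let moment_step q : 2 <= q -> q <= r ->
  N (q - 1) <= (c * (q - 1) * B) `^ ((q - 1) / 2) -> N q <= (c * q * B) `^ (q / 2).
Proof.
move=> q2 qr IH; pose A := c * q * B.
have A0 : 0 < A by rewrite !mulr_gt0 //; lra.
have q10 : 0 < q - 1 by lra.
have A10 : 0 < c * (q - 1) * B by rewrite !mulr_gt0.
have := beckner_bound q2 (energy_bound q2 qr A0).
set G := N q / A `^ (q / 2).
have As0 : 0 < A `^ (q / 2) by exact: powR_gt0.
have NG : N q = G * A `^ (q / 2) by rewrite /G divfK ?gt_eqF.
have first_le : N (q - 1) `^ (q / (q - 1)) <= (1 - theta) * A `^ (q / 2).
  apply: (@le_trans _ _ ((c * (q - 1) * B) `^ (q / 2))).
    apply: (@le_trans _ _ (((c * (q - 1) * B) `^ ((q - 1) / 2)) `^ (q / (q - 1)))).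
      by apply: ge0_ler_powR; rewrite ?nnegrE ?powR_ge0 // divr_ge0 //; lra.
    by rewrite -powRrM (_ : (q - 1) / 2 * (q / (q - 1)) = q / 2) //; field; lra.
  have -> : c * (q - 1) * B = A * ((q - 1) / q) by rewrite /A; field; lra.
  rewrite powRM ?(ltW A0) ?divr_ge0 ?(ltW q10) //; [|lra].
  rewrite mulrC ler_wpM2r ?(ltW As0) // (_ : 1 - theta = expR (- 2^-1)); last first.
    by rewrite /theta; ring.
  rewrite /powR gt_eqF ?divr_gt0 //; [|lra].
  rewrite ler_expR; have : ln ((q - 1) / q) <= (q - 1) / q - 1.
    by apply: ln_le_subr1; rewrite divr_gt0 //; lra.
  have -> : (q - 1) / q - 1 = - q^-1 by field; lra.
  have qq : q / 2 * - q^-1 = - 2^-1 by field; lra.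
  by rewrite -qq ler_pM2l //; lra.
(* The choice [A = c q B] absorbs [q * B] into one more power of [A]; what remains is
   [1 / (2 alpha c) = theta]. *)
have second_eq z : q / (2 * alpha) * (B * A `^ (q / 2 - 1) * z) = theta * z * A `^ (q / 2).
  have -> : A `^ (q / 2) = A * A `^ (q / 2 - 1) by rewrite mulr_powRB1 ?(ltW A0) //; lra.
  have -> : theta = (2 * alpha * c)^-1.
    by apply/(mulfI (_ : 2 * alpha * c != 0));
      rewrite ?c_def ?divff // gt_eqF // mulr_gt0 // mulr_gt0.
  by rewrite /A; field; rewrite !gt_eqF.
rewrite second_eq => h; rewrite -[leRHS]mul1r NG ler_pM2r //.
have {}h : G <= (1 - theta) + theta * (2 / q + (1 - 2 / q) * G).
  rewrite -(ler_pM2r As0) -NG mulrDl; apply: le_trans h _.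
  by rewrite lerD2r.
have k0 : 0 <= 2 / q <= 1 by rewrite divr_ge0 ?ler_pdivrMr ?mul1r //; lra.
move: h; set k := 2 / q in k0 *; move: k0 => /andP[k0 k1] h.
(* The inequality rearranges to [(1 - theta (1 - k)) G <= 1 - theta (1 - k)]. *)
have f0 : 0 < 1 - theta * (1 - k) by have := theta0; have := theta_lt1; nra.
by rewrite -(ler_pM2l f0); lra.
Qed.

(** Jensen's inequality from the second moment, by the tangent of [z^(q/2)] at [z = A]. All real [q]
    in [[1, 2]] are covered, since unit steps down from a real [r] end somewhere in that
    interval. *)
Let moment_base q : 1 <= q -> q <= 2 -> N q <= (c * q * B) `^ (q / 2).
Proof.
move=> q1 q2; pose A := c * q * B; rewrite -/A.
have q0 : 0 < q by lra.
have A0 : 0 < A by rewrite !mulr_gt0.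
have N2 : \int[mu]_x (g x `^ 2) <= A.
  apply: (@le_trans _ _ (B / alpha)).
    rewrite -lee_fin /Rintegral fineK; last exact: (integrable_fin_num measurableT (igq _)).
    apply: le_trans base_le; rewrite le_eqVlt; apply/orP; left; apply/eqP.
    by apply: eq_integral => x _; rewrite powR_mulrn.
  rewrite ler_pdivrMr // (_ : A * alpha = alpha * c * q * B); last by rewrite /A; ring.
  by rewrite ler_peMl ?(ltW B0) // mulr_ege1.
have As0 : 0 < A `^ (q / 2) by exact: powR_gt0.
pose k := q / 2; have k1 : k <= 1 by rewrite /k; lra.
have k0 : 0 < k by rewrite /k; lra.
have ptw x : g x `^ q <= A `^ k * (k / A) * g x `^ 2 + A `^ k * (1 - k).
  have h := @powR_le_affine R k 1 (g x `^ 2 / A) k0 k1 _.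
  have : (g x `^ 2 / A) `^ k <= k * (g x `^ 2 / A) + (1 - k).
    have := h; rewrite divr1 powRr1; first by apply; rewrite divr_ge0 ?powR_ge0 ?ltW.
    by rewrite divr_ge0 ?powR_ge0 ?ltW.
  rewrite powRM ?powR_ge0 ?invr_ge0 ?(ltW A0) // invr_powR ?(ltW A0) // -powRrM.
  rewrite (_ : 2 * k = q); last by rewrite /k; field.
  rewrite ler_pdivrMr ?powR_gt0 //; move/le_trans; apply.
  by rewrite le_eqVlt; apply/orP; left; apply/eqP; ring.
apply: (@le_trans _ _ (\int[mu]_x (A `^ k * (k / A) * g x `^ 2 + A `^ k * (1 - k)))).
  apply: le_Rintegral => //; first by apply: igq; exact: ltW.
  apply: (@integrableD _ _ _ mu setT measurableT
    (EFin \o (fun x => A `^ k * (k / A) * g x `^ 2)) (EFin \o cst (A `^ k * (1 - k)))).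
    exact: (@integrableZl _ _ _ mu setT measurableT (A `^ k * (k / A))
      (EFin \o (fun x => g x `^ 2)) (igq _)).
  exact: finite_measure_integrable_cst.
rewrite (@RintegralD _ _ _ mu setT (fun x => A `^ k * (k / A) * g x `^ 2)
  (cst (A `^ k * (1 - k)))) //; last 2 first.
- exact: (@integrableZl _ _ _ mu setT measurableT (A `^ k * (k / A))
      (EFin \o (fun x => g x `^ 2)) (igq _)).
- exact: finite_measure_integrable_cst.
rewrite Rintegral_probability_cst (@RintegralZl _ _ _ mu setT (fun x => g x `^ 2)) //; last exact: igq.
have : A `^ k * (k / A) * \int[mu]_x (g x `^ 2) <= A `^ k * (k / A) * A.
  by rewrite ler_wpM2l // mulr_ge0 ?powR_ge0 // divr_ge0 // ltW.
move=> h; apply: (le_trans (lerD h (lexx _))).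
by rewrite le_eqVlt; apply/orP; left; apply/eqP; rewrite -/k; field; rewrite gt_eqF.
Qed.

(** Induction on an integer [n] with [q <= n + 2], for all real [q] in [[1, r]] at once. The bound
    [M] on [g] only guarantees finite moments and is absent from the conclusion. *)
Lemma moment_bound : \int[mu]_x (g x `^ r) <= (c * r * B) `^ (r / 2).
Proof.
suff H n q : 1 <= q -> q <= r -> q <= n.+2%:R -> N q <= (c * q * B) `^ (q / 2).
  apply: (H (Num.truncn r)) => //; first by move: r2; lra.
  by apply/ltW/(lt_trans (truncnS_gt r)); rewrite ltr_nat.
elim: n q => [|n IHn] q q1 qr qn; first exact: moment_base.
have [q2|/ltW q2] := leP q 2; first exact: moment_base.
apply: moment_step => //; apply: IHn; [lra|lra|].
by rewrite lerBlDr natr1.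
Qed.

End moment_induction.

Lemma norm_maxrB_le (R : realDomainType) (a b c : R) :
  `|Num.max a c - Num.max b c| <= `|a - b|.
Proof.
wlog ba : a b / b <= a.
  move=> W; have [/W //|/ltW ab] := leP b a.
  by rewrite distrC [leRHS]distrC W.
rewrite !ger0_norm ?subr_ge0 //; last by rewrite ge_max !le_max ba lexx orbT.
have [ac|/ltW ca] := leP a c.
  by rewrite max_r ?subrr ?subr_ge0 // (le_trans ba).
by rewrite lerD2l lerN2 le_max lexx.
Qed.

(** * Integrability and the Poincare inequality for functions of arbitrary sign *)

Section poincare.
Context (R : realType) (I : finType) (dE : measure_display)
  (E : measurableType dE) (mu : probability (power I E) R)
  (dO : measure_display) (Omega : measurableType dO)
  (P : probability Omega R) (X : Omega -> power I E) (X' : I -> Omega -> E).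
Hypotheses (mX : measurable_fun setT X) (mX' : forall i, measurable_fun setT (X' i)).
Variables (rho0 : R) (rho0_gt0 : 0 < rho0).
Hypothesis mlsi : modified_log_sobolev mu P X X' rho0.
Implicit Types f g h : power I E -> R.

Lemma glauber_form_contract f h : measurable_fun setT h ->
  (forall x y, `|h x - h y| <= `|f x - f y|) -> in_Dom P X X' f ->
  glauber_form P X X' h h <= glauber_form P X X' f f.
Proof.
move=> mh hf Df; have [mf _] := Df.
have Dh : in_Dom P X X' h.
  by apply: (in_Dom_lipschitz (c := 1) mX mX' mh _ Df) => x y; rewrite mul1r.
rewrite -lee_fin (EFin_glauber_form mX mX' Dh Dh) (EFin_glauber_form mX mX' Df Df).
rewrite lee_wpmul2l ?lee_fin ?invr_ge0 //; apply: lee_sum => i _.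
apply: ge0_le_integral => //.
- by move=> w _; rewrite lee_fin -expr2 sqr_ge0.
- by apply/measurable_EFinP; apply: measurable_funM; exact: measurable_increment.
- by apply/measurable_EFinP; apply: measurable_funM; exact: measurable_increment.
- move=> w _; rewrite lee_fin -!expr2 -[leLHS]real_normK ?num_real //.
  by rewrite -[leRHS]real_normK ?num_real // lerXn2r ?nnegrE.
Qed.

(** The positive and negative parts of [f] are contractions of [f], hence in [Dom], and they are
    nonnegative, so [mlsi_breg] applies to each. *)
Lemma mlsi_integrable f : in_Dom P X X' f -> mu.-integrable setT (EFin \o f).
Proof.
move=> Df; have [mf _] := Df.
have Dp : in_Dom P X X' (fun x => Num.max (f x) 0).
  apply: (in_Dom_lipschitz (c := 1) mX mX' _ _ Df); first exact: measurable_maxr.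
  by move=> x y; rewrite mul1r norm_maxrB_le.
have Dm : in_Dom P X X' (fun x => Num.max (- f x) 0).
  apply: (in_Dom_lipschitz (c := 1) mX mX' _ _ Df).
    by apply: measurable_maxr => //; exact: measurableT_comp.
  by move=> x y; rewrite mul1r (le_trans (norm_maxrB_le _ _ _)) // -opprD normrN.
have max0 z : 0 <= Num.max z 0 :> R by rewrite le_max lexx orbT.
have [ip _] := mlsi_breg mX mX' mlsi (fun x => max0 (f x)) Dp ltr01.
have [im _] := mlsi_breg mX mX' mlsi (fun x => max0 (- f x)) Dm ltr01.
rewrite (_ : EFin \o f = (EFin \o (fun x => Num.max (f x) 0)%R) \-
    (EFin \o (fun x => Num.max (- f x) 0)%R))%E.
  exact: integrableB.
apply/funext => x /=; rewrite -EFinB; congr EFin.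
by have [h|h] := leP (f x) 0; [rewrite max_l ?sub0r ?opprK|rewrite max_r ?subr0]; lra.
Qed.

(** Cut [f] off below at [-n] and add [n]: the result is nonnegative, has the centred values of the
    cut-off function and no more energy than [f]. The means converge by dominated convergence, and
    Fatou's lemma passes to the limit. *)
Lemma mlsi_poincare f : in_Dom P X X' f ->
  (\int[mu]_x ((f x - (\int[mu]_x f x)%R) ^+ 2)%:E <=
     (6 / rho0 * glauber_form P X X' f f)%:E)%E.
Proof.
move=> Df; have [mf _] := Df; set m := (\int[mu]_x f x)%R; set C := (_%:E)%E.
have if_ := mlsi_integrable Df.
pose v n x := Num.max (f x) (- n%:R).
have mv n : measurable_fun setT (v n) by exact: measurable_maxr.
have v_le n x : `|v n x| <= `|f x|.
  rewrite /v; have [|/ltW nf] := leP (f x) (- n%:R); last by [].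
  move=> fn; rewrite normrN ger0_norm // ler_normr; apply/orP; right; lra.
have iv n : mu.-integrable setT (EFin \o v n).
  apply: le_integrable if_ => //; first exact/measurable_EFinP.
  by move=> x _ /=; rewrite lee_fin.
have cv x : v n x @[n --> \oo] --> f x.
  apply: cvg_near_cst; exists (Num.truncn `|f x|).+1 => // n /= hn.
  rewrite /v max_l //; have := truncnS_gt `|f x|; have : - f x <= `|f x| by rewrite -normrN ler_norm.
  have : (Num.truncn `|f x|).+1%:R <= n%:R :> R by rewrite ler_nat.
  lra.
have cm : (\int[mu]_x v n x)%R @[n --> \oo] --> m.
  have [] := @dominated_convergence _ _ _ mu setT measurableT
    (fun n => EFin \o v n) (EFin \o f) (abse \o (EFin \o f)).
  - by move=> n; exact/measurable_EFinP.
  - exact/measurable_EFinP.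
  - by apply/aeW => x _; apply: cvg_EFin; [exact: nearW|exact: cv].
  - exact: integrable_abse.
  - by apply/aeW => x n _; rewrite /= lee_fin.
  move=> _ _ H; have : (fine (\int[mu]_x (v n x)%:E))%:E @[n --> \oo] --> m%:E.
    under eq_fun do rewrite fineK ?(integrable_fin_num measurableT (iv _)) //.
    by rewrite fineK //; exact: integrable_fin_num.
  by move/fine_cvgP => [].
have bound n : (\int[mu]_x ((v n x - (\int[mu]_x v n x)%R) ^+ 2)%:E <= C)%E.
  pose u x := v n x + n%:R.
  have u0 x : 0 <= u x by rewrite /u -lerBlDr sub0r /v le_max lexx orbT.
  have mu_ : measurable_fun setT u by exact: measurable_funD.
  have uf x y : `|u x - u y| <= `|f x - f y|.
    rewrite /u (_ : v n x + n%:R - (v n y + n%:R) = v n x - v n y); last by ring.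
    exact: norm_maxrB_le.
  have Du : in_Dom P X X' u.
    by apply: (in_Dom_lipschitz (c := 1) mX mX' mu_ _ Df) => x y; rewrite mul1r.
  have [_ pu] := mlsi_poincare_ge0 mX mX' rho0_gt0 mlsi u0 Du.
  apply: (@le_trans _ _ (6 / rho0 * glauber_form P X X' u u)%:E); last first.
    by rewrite lee_fin ler_pM2l ?divr_gt0 // glauber_form_contract.
  apply: le_trans pu; rewrite le_eqVlt; apply/orP; left; apply/eqP.
  apply: eq_integral => x _; congr ((_ ^+ 2)%:E); rewrite /u.
  rewrite (@RintegralD _ _ _ mu setT (v n) (cst n%:R)) //; last exact: finite_measure_integrable_cst.
  by rewrite Rintegral_probability_cst; ring.
apply: (@le_trans _ _ (limn_einf (fun n => \int[mu]_x ((v n x - (\int[mu]_x v n x)%R) ^+ 2)%:E))%E).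
  apply: le_trans (fatou mu measurableT _ _).
  - rewrite le_eqVlt; apply/orP; left; apply/eqP; apply: eq_integral => x _.
    have cvx : ((v n x - (\int[mu]_x v n x)%R) ^+ 2)%:E @[n --> \oo] --> ((f x - m) ^+ 2)%:E.
      apply: cvg_EFin; first exact: nearW.
      have c1 : v n x - (\int[mu]_x v n x)%R @[n --> \oo] --> f x - m by exact: (cvgB (cv x) cm).
      exact: (cvgM c1 c1).
    by rewrite is_cvg_limn_einfE; [apply/esym/cvg_lim|apply/cvg_ex; eexists; exact: cvx].
  - by move=> n; apply/measurable_EFinP; apply: measurable_funX; exact: measurable_funB.
  - by move=> n x _; rewrite lee_fin sqr_ge0.
rewrite limn_einf_lim; apply: lime_le; first exact: is_cvg_einfs.
apply: nearW => n; apply: le_trans (bound n).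
by apply: ereal_inf_lbound; exists n => //=.
Qed.

End poincare.

Lemma ge0_integral_trunc_le d (T : measurableType d) (R : realType)
    (m : {measure set T -> \bar R}) (h : T -> \bar R) (C : \bar R) :
  measurable_fun setT h -> (forall x, 0 <= h x)%E ->
  (forall n, \int[m]_x mine (h x) n%:R%:E <= C)%E -> (\int[m]_x h x <= C)%E.
Proof.
move=> mh h0 hC.
have cvh x : mine (h x) n%:R%:E @[n --> \oo] --> h x.
  have := h0 x; case: (h x) => [r r0|_|//].
    apply: cvg_near_cst; exists (Num.truncn r).+1 => // n /= hn.
    rewrite min_l // lee_fin ltW //; apply: (lt_le_trans (truncnS_gt r)).
    by rewrite ler_nat.
  rewrite (_ : (fun n => mine +oo n%:R%:E)%E = (fun n => n%:R%:E)%E).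
    by apply/cvgenyP; exact: cvg_id.
  by apply/funext => n; rewrite min_r // leey.
have -> : (\int[m]_x h x = limn (fun n => \int[m]_x mine (h x) n%:R%:E))%E.
  rewrite -monotone_convergence //.
  - by apply: eq_integral => x _; apply/esym/cvg_lim.
  - by move=> n; apply: measurable_mine.
  - by move=> n x _; rewrite le_min h0 lee_fin ler0n.
  - move=> x _ a b ab; rewrite le_min ge_min lexx /= ge_min; apply/orP; right.
    by rewrite lee_fin ler_nat.
apply: lime_le; last exact: nearW.
apply: ereal_nondecreasing_is_cvgn => a b ab; apply: ge0_le_integral => //.
- by move=> x _; rewrite le_min h0 lee_fin ler0n.
- exact: measurable_mine.
- exact: measurable_mine.
- move=> x _; rewrite le_min ge_min lexx /= ge_min; apply/orP; right.
  by rewrite lee_fin ler_nat.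
Qed.

(** * Conditional expectations of nonnegative variables and their contraction of moments *)

Section conditional_expectation.
Context (R : realType) dO (Omega : measurableType dO) (P : probability Omega R)
  dT (T : measurableType dT) (X : Omega -> T).
Hypothesis mX : measurable_fun setT X.
Local Open Scope ereal_scope.

Let measurable_id : measurable_fun setT (fun w : Omega => w : g_sigma_algebra_preimageType X).
Proof.
move=> _ A [B mB <-]; rewrite setTI.
exact: mX.
Qed.

Lemma measurable_fun_preimageType d2 (T2 : measurableType d2) (Y : Omega -> T2) :
  measurable_fun setT (Y : g_sigma_algebra_preimageType X -> T2) -> measurable_fun setT Y.
Proof. by move=> mY; exact: (measurableT_comp mY measurable_id). Qed.

Lemma measurable_fun_preimage d2 (T2 : measurableType d2) (g : T -> T2) :
  measurable_fun setT g ->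
  measurable_fun setT (fun w : g_sigma_algebra_preimageType X => g (X w)).
Proof.
move=> mg _ B mB; rewrite setTI; exists (g @^-1` B); last by rewrite setTI.
by rewrite -[X in measurable X]setTI; exact: mg.
Qed.

(** The pull-out property, from [integral_weight_eq] for the identity seen as a map from [Omega] to
    the sigma-algebra of [X]. *)
Lemma cond_expectationM (Z Y h : Omega -> \bar R) : is_cond_expectation P X Z Y ->
  measurable_fun setT Z -> (forall w, 0 <= Z w) ->
  measurable_fun setT (h : g_sigma_algebra_preimageType X -> \bar R) ->
  (forall w, 0 <= h w) ->
  \int[P]_w (Y w * h w) = \int[P]_w (Z w * h w).
Proof.
move=> [Y0 mY YZ] mZ Z0 mh h0.
apply: (integral_weight_eq measurable_id (m := P) (u := Y) (v := Z) (h := h)) => //.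
  exact: measurable_fun_preimageType.
Qed.

Lemma cond_expectation_sum (I : finType) (Z V : I -> Omega -> \bar R) :
  (forall i, measurable_fun setT (Z i)) -> (forall i w, 0 <= Z i w) ->
  (forall i, is_cond_expectation P X (Z i) (V i)) ->
  is_cond_expectation P X (fun w => \sum_(i : I) Z i w) (fun w => \sum_(i : I) V i w).
Proof.
move=> mZ Z0 ZV.
have V0 i w : 0 <= V i w by have [] := ZV i.
have mV i : measurable_fun setT (V i : g_sigma_algebra_preimageType X -> \bar R) by have [] := ZV i.
split.
- by move=> w; apply: sume_ge0 => i _.
- exact: emeasurable_sum.
- move=> A GA.
  have mA : measurable A by rewrite -[A]setTI; exact: (measurable_id measurableT GA).
  rewrite ge0_integral_sum //; last by move=> i; apply: measurable_funTS; exact: measurable_fun_preimageType.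
  rewrite ge0_integral_sum //; last by move=> i; apply: measurable_funTS.
  by apply: eq_bigr => i _; have [_ _ ->] := ZV i.
Qed.

(** Conditional Jensen by duality. For a truncation [y] of [Y], the integral [K] of [y^q] is at most
    that of [Y y^(q-1)], which equals that of [s y^(q-1)] by pull-out; the tangent inequality then
    gives [q K <= (q - 1) K + S]. *)
Lemma cond_expectation_powR_le (s : Omega -> R) (Y : Omega -> \bar R) (q : R) :
  measurable_fun setT s -> (forall w, (0 <= s w)%R) -> (1 <= q)%R ->
  is_cond_expectation P X (EFin \o s) Y ->
  \int[P]_w (Y w `^ q) <= \int[P]_w (s w `^ q)%:E.
Proof.
move=> ms s0 q1 sY; have [Y0 mY _] := sY.
have q0 : (0 < q)%R by lra.
have mYO := measurable_fun_preimageType mY.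
apply: ge0_integral_trunc_le.
- exact: (measurableT_comp (measurable_poweR q) mYO).
- by move=> w; exact: poweR_ge0.
(* The level is chosen so that [t^q = n]: truncating [Y] at [t] truncates [Y^q] at [n]. *)
move=> n; pose t : R := (n%:R `^ q^-1)%R.
have t0 : (0 <= t)%R by exact: powR_ge0.
have tq : (t `^ q)%R = n%:R by rewrite /t -powRrM mulVf ?gt_eqF // powRr1.
pose y w := fine (mine (Y w) t%:E).
have yE w : (y w)%:E = mine (Y w) t%:E.
  rewrite fineK // ge0_fin_numE ?le_min ?Y0 ?lee_fin //.
  by rewrite gt_min ltry orbT.
have y0 w : (0 <= y w)%R by rewrite -lee_fin yE le_min Y0 lee_fin.
have yt w : (y w <= t)%R by rewrite -lee_fin yE ge_min lexx orbT.
have yY w : (y w)%:E <= Y w by rewrite yE ge_min lexx.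
have my : measurable_fun setT (y : g_sigma_algebra_preimageType X -> R).
  by apply: measurableT_comp => //; exact: measurable_mine.
have myO : measurable_fun setT y by exact: measurable_fun_preimageType.
have yqE w : mine (Y w `^ q) n%:R%:E = (y w `^ q)%:E.
  rewrite -poweR_EFin yE -tq -poweR_EFin.
  have [h|/ltW h] := leP (Y w) t%:E.
    by rewrite min_l // gt0_ler_poweR // ?in_itv /= ?Y0 ?leey ?lee_fin ?t0 // ltW.
  by rewrite min_r // gt0_ler_poweR // ?in_itv /= ?Y0 ?leey ?lee_fin ?t0 // ltW.
under eq_integral do rewrite yqE.
have mypow z : measurable_fun setT (fun w => (y w `^ z)%:E).
  by apply/measurable_EFinP; exact: (measurableT_comp (measurable_powR z) myO).
have mspow : measurable_fun setT (fun w => (s w `^ q)%:E).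
  by apply/measurable_EFinP; exact: (measurableT_comp (measurable_powR q) ms).
set K := \int[P]_w (y w `^ q)%:E; set S := \int[P]_w (s w `^ q)%:E.
have K0 : 0 <= K by apply: integral_ge0 => w _; rewrite lee_fin powR_ge0.
have S0 : 0 <= S by apply: integral_ge0 => w _; rewrite lee_fin powR_ge0.
have Kfin : K \is a fin_num.
  rewrite ge0_fin_numE //; apply: (@le_lt_trans _ _ (\int[P]__ (t `^ q)%:E)).
    apply: ge0_le_integral => //.
    - by move=> w _; rewrite lee_fin powR_ge0.
    - by move=> w _; rewrite lee_fin ge0_ler_powR ?nnegrE // ltW.
  by rewrite integral_probability_cst ltry.
have KM : K <= \int[P]_w ((s w)%:E * (y w `^ (q - 1))%:E).
  rewrite -(cond_expectationM sY (h := fun w => (y w `^ (q - 1))%:E)); first last.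
  - by move=> w; rewrite lee_fin powR_ge0.
  - by apply/measurable_EFinP; exact: (measurableT_comp (measurable_powR (q - 1)) my).
  - by move=> w; rewrite lee_fin.
  - exact/measurable_EFinP.
  apply: ge0_le_integral => //.
  - by move=> w _; rewrite lee_fin powR_ge0.
  - exact: emeasurable_funM.
  - move=> w _; rewrite -(mulr_powRB1 (y0 w) q0) EFinM.
    by rewrite lee_wpmul2r ?lee_fin ?powR_ge0.
have Tan : q%:E * \int[P]_w ((s w)%:E * (y w `^ (q - 1))%:E) <= (q - 1)%:E * K + S.
  have q10 : (0 <= q - 1)%R by lra.
  rewrite -ge0_integralZl_EFin ?(ltW q0) //; last 2 first.
  - by move=> w _; rewrite mule_ge0 // lee_fin ?powR_ge0.
  - by apply: emeasurable_funM => //; exact/measurable_EFinP.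
  rewrite -ge0_integralZl_EFin //; last by move=> w _; rewrite lee_fin powR_ge0.
  rewrite -ge0_integralD //; last 3 first.
  - by move=> w _; rewrite mule_ge0 // lee_fin powR_ge0.
  - exact: measurable_funeM.
  - by move=> w _; rewrite lee_fin powR_ge0.
  apply: ge0_le_integral => //.
  - by move=> w _; rewrite -!EFinM lee_fin !mulr_ge0 ?powR_ge0 // ltW.
  - by apply: measurable_funeM; apply: emeasurable_funM => //; exact/measurable_EFinP.
  - by apply: emeasurable_funD => //; exact: measurable_funeM.
  - move=> w _; rewrite -!EFinM -EFinD lee_fin (mulrC (s w)).
    exact: powR_tangent.
(* [K] is finite thanks to the truncation, so [(q - 1) K] can be subtracted. *)
have : q%:E * K <= (q - 1)%:E * K + S.
  by apply: le_trans Tan; rewrite lee_wpmul2l // lee_fin ltW.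
move: Kfin S0; case: K {K0 KM Tan} => // k _; case: S => [S' _|_ _|//]; last exact: leey.
by rewrite -!EFinM -EFinD !lee_fin; lra.
Qed.

End conditional_expectation.

Lemma Lnorm_sqrte d (T : measurableType d) (R : realType) (m : {measure set T -> \bar R})
    (W : T -> \bar R) (r : R) : (forall w, 0 <= W w)%E ->
  'N[m]_r%:E[(fun w => sqrte (W w))]%E = ((\int[m]_w (W w `^ (r / 2))) `^ r^-1)%E.
Proof.
move=> W0; rewrite unlock; congr (_ `^ _)%E; apply: eq_integral => w _.
rewrite gee0_abs ?sqrte_ge0 // -poweR12_sqrt // -poweRrM.
by congr (_ `^ _)%E; rewrite mulrC.
Qed.

(** Integrate the tangent bound [x <= x^t / t + 1 - 1 / t] at [x = W / B]. A value [+oo] of [W] is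
    harmless because the coefficient of [W^t] is positive. *)
Lemma integral_le_poweR d (T : measurableType d) (R : realType) (P : probability T R)
    (W : T -> \bar R) (t B : R) : measurable_fun setT W -> (forall w, 0 <= W w)%E ->
  1 <= t -> 0 < B -> (\int[P]_w (W w `^ t) <= (B `^ t)%:E)%E ->
  (\int[P]_w W w <= B%:E)%E.
Proof.
move=> mW W0 t1 B0 WB; have t0 : 0 < t by lra.
have Bt0 : 0 < B `^ t by exact: powR_gt0.
pose k1 := B / t / B `^ t; pose k2 := B * (1 - t^-1).
have k10 : 0 < k1 by rewrite /k1; apply: divr_gt0 => //; apply: divr_gt0.
have k20 : 0 <= k2 by rewrite mulr_ge0 ?(ltW B0) // subr_ge0 invf_le1.
have mWt : measurable_fun setT (fun w => W w `^ t)%E.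
  exact: (measurableT_comp (measurable_poweR t) mW).
apply: (@le_trans _ _ (\int[P]_w (k1%:E * W w `^ t + k2%:E))%E).
  apply: ge0_le_integral => //.
  - by apply: emeasurable_funD => //; exact: measurable_funeM.
  - move=> w _; have := W0 w; case: (W w) => [v v0|_|//]; last first.
      by rewrite poweRyr ?gt_eqF // gt0_muley ?lte_fin // addye // leey.
    rewrite poweR_EFin -!EFinM -EFinD lee_fin; rewrite lee_fin in v0.
    have x0 : 0 <= v / B by rewrite divr_ge0 // ltW.
    have := powR_le_affine ltr01 t1 x0.
    rewrite powRr1 // powRM ?invr_ge0 ?(ltW B0) // invr_powR ?(ltW B0) //.
    rewrite ler_pdivrMr // => /le_trans; apply; rewrite le_eqVlt; apply/orP; left; apply/eqP.
    by rewrite /k1 /k2; field; rewrite !gt_eqF.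
rewrite ge0_integralD //; last 2 first.
- by move=> w _; rewrite mule_ge0 ?poweR_ge0 // lee_fin ltW.
- exact: measurable_funeM.
rewrite ge0_integralZl_EFin ?(ltW k10) //; last by move=> w _; rewrite poweR_ge0.
rewrite integral_probability_cst; apply: (@le_trans _ _ (k1%:E * (B `^ t)%:E + k2%:E)%E).
  by rewrite leeD2r // lee_wpmul2l // lee_fin ltW.
rewrite -EFinM -EFinD lee_fin /k1 /k2 le_eqVlt; apply/orP; left; apply/eqP.
by field; rewrite !gt_eqF.
Qed.

(** * Norm estimates for a general deviation [T] and energy density [psi], covering the one-sided
    and the two-sided case *)

Section moment_estimates.
Context (R : realType) (I : finType) (dE : measure_display)
  (E : measurableType dE) (mu : probability (power I E) R)
  (dO : measure_display) (Omega : measurableType dO)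
  (P : probability Omega R) (X : Omega -> power I E) (X' : I -> Omega -> E).
Hypotheses (mX : measurable_fun setT X) (mX' : forall i, measurable_fun setT (X' i)).
Hypothesis X_law : forall A, measurable A -> P (X @^-1` A) = mu A.
Hypothesis exch : forall i (F : power I E * power I E -> \bar R),
  measurable_fun setT F -> (forall z, 0 <= F z)%E ->
  (\int[P]_w F (X w, Xi X X' i w) = \int[P]_w F (Xi X X' i w, X w))%E.
Variables (rho0 : R) (rho0_gt0 : 0 < rho0).
Hypothesis mlsi : modified_log_sobolev mu P X X' rho0.
Variables (f : power I E -> R) (psi T : R -> R) (V : I -> Omega -> \bar R) (r : R).
Hypotheses (mf : measurable_fun setT f) (r2 : 2 <= r).
Hypotheses (mpsi : measurable_fun setT psi) (psi0 : forall z, 0 <= psi z).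
Hypotheses (mT : measurable_fun setT T) (T0 : forall z, 0 <= T z) (T_le : forall z, T z <= `|z|).
Hypothesis T_psi : forall a b, Num.max (T a - T b) 0 ^+ 2 <= psi (a - b).
Let D i w := f (X w) - f (Xi X X' i w).
Hypothesis D_psi : (\sum_(i : I) \int[P]_w (D i w ^+ 2)%:E <=
  2%:E * \sum_(i : I) \int[P]_w (psi (D i w))%:E)%E.
Hypothesis V_cond : forall i, is_cond_expectation P X (fun w => (psi (D i w))%:E) (V i).

Let W w := (\sum_(i : I) V i w)%E.
Let s w := \sum_(i : I) psi (D i w).

Let mD i : measurable_fun setT (D i).
Proof. exact: measurable_increment. Qed.

Let mpsiD i : measurable_fun setT (fun w => psi (D i w)).
Proof. exact: (measurableT_comp mpsi (mD i)). Qed.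

Let ms : measurable_fun setT s.
Proof. exact: measurable_sum. Qed.

Let s0 w : 0 <= s w.
Proof. by apply: sumr_ge0 => i _. Qed.

Let sW : is_cond_expectation P X (EFin \o s) W.
Proof.
have -> : EFin \o s = (fun w => \sum_(i : I) (psi (D i w))%:E)%E.
  by apply/funext => w /=; rewrite /s sumEFin.
apply: (cond_expectation_sum mX) => [i|i w|//]; last by rewrite lee_fin.
exact/measurable_EFinP.
Qed.

Let W0 w : (0 <= W w)%E.
Proof. by have [] := sW. Qed.

Let mW : measurable_fun setT W.
Proof. by have [_ mWX _] := sW; exact: (measurable_fun_preimageType mX mWX). Qed.

Let sum_psi : (\sum_(i : I) \int[P]_w (psi (D i w))%:E = \int[P]_w W w)%E.
Proof.
have [_ _ ->] := sW; last by exists setT; rewrite // setTI preimage_setT.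
under [RHS]eq_integral do rewrite /= /s -sumEFin.
rewrite ge0_integral_sum //; first by move=> i; exact/measurable_EFinP.
by move=> i w _; rewrite lee_fin.
Qed.

(** Conditional Jensen with the exponent [r / 2], which is at least 1 because [r >= 2]. *)
Lemma cond_mid_le_rhs : ('N[P]_r%:E[(fun w => sqrte (\sum_(i : I) V i w))] <=
  'N[P]_r%:E[(fun w => (Num.sqrt (\sum_(i : I) psi (D i w))%R)%:E)])%E.
Proof.
have r1 : 1 <= r / 2 by rewrite ler_pdivlMr //; move: r2; lra.
rewrite (_ : (fun w => (Num.sqrt _)%:E) = (fun w => sqrte (s w)%:E)) //.
rewrite !Lnorm_sqrte //.
apply: gt0_ler_poweR; rewrite ?invr_ge0 ?in_itv /= ?leey ?andbT.
- by move: r2; lra.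
- by apply: integral_ge0 => w _; exact: poweR_ge0.
- by apply: integral_ge0 => w _; rewrite lee_fin powR_ge0.
- exact: (cond_expectation_powR_le mX ms s0 r1 sW).
Qed.

Let m := \int[mu]_x f x.

Section fixed_bound.
Variable B : R.
Hypotheses (B0 : 0 < B) (W_le : (\int[P]_w (W w `^ (r / 2)) <= (B `^ (r / 2))%:E)%E).

Let r1 : 1 <= r / 2.
Proof. by rewrite ler_pdivlMr //; move: r2; lra. Qed.

Let EW_le : (\int[P]_w W w <= B%:E)%E.
Proof. exact: integral_le_poweR r1 B0 W_le. Qed.

(** A finite middle term already puts [f] in [Dom]: through [D_psi] even a one-sided energy controls
    the full squared increments. Integrability of [f], the well-definedness part of the estimate,
    follows. *)
Let Df : in_Dom P X X' f.
Proof.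
split => //; apply: le_lt_trans D_psi _.
by rewrite sum_psi lte_mul_pinfty // (le_lt_trans EW_le) ?ltry.
Qed.

Lemma integrable_of_bound : mu.-integrable setT (EFin \o f).
Proof. exact: (mlsi_integrable mX mX' mlsi Df). Qed.

Let variance_le : (\int[mu]_x ((f x - m) ^+ 2)%:E <= (B / (rho0 / 6))%:E)%E.
Proof.
apply: le_trans (mlsi_poincare mX mX' rho0_gt0 mlsi Df) _.
have -> : B / (rho0 / 6) = 6 / rho0 * B by field; rewrite gt_eqF.
rewrite lee_fin ler_pM2l ?divr_gt0 // -lee_fin (EFin_glauber_form mX mX' Df Df).
apply: le_trans EW_le.
apply: (@le_trans _ _ (2^-1%:E * (2%:E * \int[P]_w W w))%E).
  by rewrite lee_wpmul2l ?lee_fin ?invr_ge0 // -sum_psi.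
by rewrite muleA -EFinM mulVf // mul1e.
Qed.

Lemma T_moment_le (c : R) : 2 * (rho0 / 6) * c * (1 - expR (- 2^-1)) = 1 ->
  (\int[P]_w (T (f (X w) - m) `^ r)%:E <= ((c * r * B) `^ (r / 2))%:E)%E.
Proof.
move=> c_def; have r0 : 0 < r by move: r2; lra.
have mfm : measurable_fun setT (fun x => f x - m) by exact: measurable_funB.
have mTf : measurable_fun setT (fun x => T (f x - m)) by exact: (measurableT_comp mT mfm).
have mTfr : measurable_fun setT (fun x => (T (f x - m) `^ r)%:E).
  by apply/measurable_EFinP; exact: (measurableT_comp (measurable_powR r) mTf).
rewrite -(ge0_integral_law (m2 := mu) (h := fun x => (T (f x - m) `^ r)%:E) mX) //; last first.
  by move=> x; rewrite lee_fin powR_ge0.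
apply: ge0_integral_trunc_le => //; first by move=> x; rewrite lee_fin powR_ge0.
(* Since [M^r = n], truncating [T (f - m)] at [M] truncates its power of order [r] at [n]; the bound
   obtained is the same for all [n]. *)
move=> n; pose M : R := n%:R `^ r^-1; have M0 : 0 <= M by exact: powR_ge0.
pose g x := Num.min (T (f x - m)) M.
have g0 x : 0 <= g x by rewrite le_min T0.
have gM x : g x <= M by rewrite ge_min lexx orbT.
have mg : measurable_fun setT g by exact: measurable_minr.
have -> : (\int[mu]_x mine (T (f x - m) `^ r)%:E n%:R%:E =
    (\int[mu]_x (g x `^ r))%:E)%E.
  have Mr : M `^ r = n%:R by rewrite /M -powRrM mulVf ?gt_eqF // powRr1.
  rewrite /Rintegral fineK; last first.
    apply: integrable_fin_num => //.
    apply: (@integrable_probability_bounded _ _ _ mu _ (M `^ r)) => [|x].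
      exact: (measurableT_comp (measurable_powR r) mg).
    by rewrite powR_ge0 ge0_ler_powR ?nnegrE // ltW.
  apply: eq_integral => x _; rewrite -EFin_min -Mr /g; congr EFin.
  have [h|/ltW h] := leP (T (f x - m)) M.
    by rewrite min_l // ge0_ler_powR ?nnegrE // ltW.
  by rewrite min_r // ge0_ler_powR ?nnegrE // ltW.
rewrite lee_fin; apply: (moment_bound mX mX' X_law exch _ c_def _ mg g0 gM mW W0 B0 r2 W_le).
- by rewrite divr_gt0.
- by move=> p /(mlsi_beckner mX mX' rho0_gt0 mlsi).
- move=> q q2; have mgq : measurable_fun setT (fun x => g x `^ (q - 2)).
    exact: (measurableT_comp (measurable_powR (q - 2)) mg).
  have mgqX : measurable_fun setT (fun w => (g (X w) `^ (q - 2))%:E).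
    by apply/measurable_EFinP; exact: (measurableT_comp mgq mX).
  (* The weight is a function of [X], so the conditional energy [W] may be replaced by the sum of
     the [psi (D i)]. *)
  rewrite (cond_expectationM mX sW); first last.
  + by move=> w; rewrite lee_fin powR_ge0.
  + apply: (measurable_fun_preimage (g := fun x => (g x `^ (q - 2))%:E)).
    exact/measurable_EFinP.
  + by move=> w; rewrite lee_fin.
  + exact/measurable_EFinP.
  have -> : (\int[P]_w ((EFin \o s) w * (g (X w) `^ (q - 2))%:E) =
      \sum_(i : I) \int[P]_w ((psi (D i w))%:E * (g (X w) `^ (q - 2))%:E))%E.
    rewrite -ge0_integral_sum //; last 2 first.
    - by move=> i; apply: emeasurable_funM => //; exact/measurable_EFinP.
    - by move=> i w _; rewrite mule_ge0 // lee_fin ?powR_ge0.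
    apply: eq_integral => w _; rewrite /= /s -sumEFin ge0_sume_distrl //.
    by move=> i _; rewrite lee_fin.
  apply: lee_sum => i _; apply: ge0_le_integral => //.
  + by move=> w _; rewrite lee_fin mulr_ge0 ?powR_ge0 ?sqr_ge0.
  + apply/measurable_EFinP; apply: measurable_funM; first exact: (measurableT_comp mgq mX).
    apply: measurable_funX; apply: measurable_maxr => //.
    exact: (measurable_increment mX mX' i mg).
  + by apply: emeasurable_funM => //; exact/measurable_EFinP.
  + move=> w _; rewrite -EFinM lee_fin mulrC ler_wpM2r ?powR_ge0 //.
    set a := f (X w) - m; set b := f (Xi X X' i w) - m.
    apply: (@le_trans _ _ (Num.max (T a - T b) 0 ^+ 2)).
      (* The minimum with a constant is nondecreasing and contracts distances, so truncation can
         only shrink the positive part of an increment. *)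
      have h : Num.max (g (X w) - g (Xi X X' i w)) 0 <= Num.max (T a - T b) 0.
        rewrite ge_max !le_max lexx !orbT andbT /g -/a -/b.
        have [hb|/ltW hb] := leP (T b) M; first by rewrite lerD2r ge_min lexx.
        by rewrite subr_le0 ge_min lexx !orbT.
      by rewrite lerXn2r // nnegrE le_max lexx orbT.
    by apply: le_trans (T_psi a b) _; rewrite /a /b /D (_ : _ - m - _ = f (X w) - f (Xi X X' i w)) //; ring.
- apply: le_trans variance_le; apply: ge0_le_integral => //.
  + by move=> x _; rewrite lee_fin sqr_ge0.
  + by apply/measurable_EFinP; exact: measurable_funX.
  + by apply/measurable_EFinP; exact: measurable_funX.
  + move=> x _; rewrite lee_fin -[leRHS]real_normK ?num_real // lerXn2r ?nnegrE //.
    by rewrite ge_min T_le.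
Qed.

End fixed_bound.

Lemma moment_estimate (c : R) : 2 * (rho0 / 6) * c * (1 - expR (- 2^-1)) = 1 ->
  let mid := ((Num.sqrt c * Num.sqrt r)%:E *
    'N[P]_r%:E[(fun w => sqrte (\sum_(i : I) V i w))])%E in
  estimate (P.-integrable setT (fun w => (f (X w))%:E))
    'N[P]_r%:E[(fun w => (T (f (X w) - fine 'E_P[f \o X]))%:E)]%E mid.
Proof.
move=> c_def mid; rewrite /mid => {mid}; set N := Lnorm _ _ (fun w => sqrte _); move=> mid_lty.
have r0 : 0 < r by move: r2; lra.
have th0 : 0 < 1 - expR (- 2^-1) :> R by rewrite subr_gt0 expR_lt1 oppr_lt0 invr_gt0.
have c0 : 0 < c.
  have : 0 < 2 * (rho0 / 6) * c * (1 - expR (- 2^-1)) by rewrite c_def.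
  by rewrite pmulr_lgt0 // pmulr_rgt0 // mulr_gt0 // divr_gt0.
pose k := Num.sqrt c * Num.sqrt r; have k0 : 0 < k by rewrite mulr_gt0 ?sqrtr_gt0.
have {}mid_lty : (k%:E * N < +oo)%E by exact: mid_lty.
rewrite -/k.
have N0 : (0 <= N)%E by exact: Lnorm_ge0.
have Nfin : N \is a fin_num.
  rewrite ge0_fin_numE // ltNge leye_eq; apply/negP => /eqP Ny.
  by move: mid_lty; rewrite Ny gt0_muley ?lte_fin.
pose b := fine N; have Nb : N = b%:E by rewrite fineK.
have b0 : 0 <= b by rewrite fine_ge0.
have J0 : (0 <= \int[P]_w (W w `^ (r / 2)))%E.
  by apply: integral_ge0 => w _; exact: poweR_ge0.
have JE : (\int[P]_w (W w `^ (r / 2)) = (b `^ r)%:E)%E.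
  rewrite -poweR_EFin -Nb /N Lnorm_sqrte // -poweRrM mulVf ?gt_eqF // poweRe1 //.
(* [b] may be 0 while [T_moment_le] asks for a positive bound; the slack [e] is removed at the
   end. *)
pose B e := (b + e) ^+ 2.
have B0 e : 0 < e -> 0 < B e by move=> e0; rewrite exprn_gt0 // ltr_wpDl.
have sqr_pow y : 0 <= y -> (y ^+ 2) `^ (r / 2) = y `^ r.
  by move=> y0; rewrite -powR_mulrn // -powRrM; congr (_ `^ _); field.
have WB e : 0 < e -> (\int[P]_w (W w `^ (r / 2)) <= (B e `^ (r / 2))%:E)%E.
  move=> e0; rewrite JE lee_fin sqr_pow ?addr_ge0 ?(ltW e0) //.
  by rewrite ge0_ler_powR ?nnegrE ?addr_ge0 ?(ltW e0) ?(ltW r0) // lerDl ltW.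
have if_ := integrable_of_bound (B0 _ ltr01) (WB _ ltr01).
have iPf : P.-integrable setT (fun w => (f (X w))%:E).
  apply/integrableP; split; first by apply/measurable_EFinP; exact: (measurableT_comp mf mX).
  rewrite -(ge0_integral_law (m2 := mu) (h := fun x => `|(f x)%:E|%E) mX) //.
    by move/integrableP : if_ => [].
  by apply: measurableT_comp => //; exact/measurable_EFinP.
split=> //.
have -> : fine 'E_P[f \o X] = m.
  rewrite unlock /m /Rintegral; congr fine.
  transitivity (\int[pushforward P X]_x (EFin \o f) x)%E.
    rewrite integral_pushforward //; exact/measurable_EFinP.
  by apply: eq_measure_integral => A mA _; exact: X_law.
apply/lee_addgt0Pr => e e0; rewrite Nb -EFinM -EFinD.
pose e' := e / k; have e'0 : 0 < e' by rewrite divr_gt0.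
have -> : k * b + e = k * (b + e') by rewrite /e'; field; rewrite gt_eqF.
have be0 : 0 <= b + e' by rewrite addr_ge0 // ltW.
have kbe0 : 0 <= k * (b + e') by rewrite mulr_ge0 // ltW.
have := T_moment_le (B0 _ e'0) (WB _ e'0) c_def.
(* With [k = sqrt c * sqrt r] the bound becomes a square, so its power of order [r / 2] followed by
   the root of order [r] gives [k * (b + e')]. *)
have -> : c * r * B e' = (k * (b + e')) ^+ 2.
  by rewrite /B /k !exprMn !sqr_sqrtr // ltW.
rewrite sqr_pow // => TB.
rewrite unlock; under eq_integral do rewrite gee0_abs ?lee_fin // poweR_EFin.
apply: (@le_trans _ _ ((((k * (b + e')) `^ r)%:E) `^ r^-1)%E).
  apply: gt0_ler_poweR; rewrite ?invr_ge0 ?in_itv /= ?leey ?andbT ?(ltW r0) //.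
  - by apply: integral_ge0 => w _; rewrite lee_fin powR_ge0.
  - by rewrite lee_fin powR_ge0.
by rewrite poweR_EFin -powRrM mulfV ?gt_eqF // powRr1.
Qed.

End moment_estimates.

(** Solving [2 alpha c (1 - e^(-1/2)) = 1] for [c] at [alpha = rho0 / 6] gives
    [3 / (rho0 (1 - e^(-1/2)))], which is the square of the constant [K] of the estimates. *)
Lemma mlsi_moment_constant (R : realType) (rho0 : R) : 0 < rho0 ->
  2 * (rho0 / 6) * (3 * Num.sqrt (expR 1) / (rho0 * (Num.sqrt (expR 1) - 1)))
    * (1 - expR (- 2^-1)) = 1.
Proof.
move=> rho0_gt0.
have -> : Num.sqrt (expR 1) = expR (2^-1) :> R.
  rewrite -powR12_sqrt ?expR_ge0 // -expRM mul1r //.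
have e1 : 1 < expR (2^-1) :> R by rewrite expR_gt1 invr_gt0.
by rewrite expRN; field; rewrite !gt_eqF ?expR_gt0 ?subr_gt0.
Qed.

Lemma maxr0_sqr (R : realDomainType) (a : R) :
  a ^+ 2 = Num.max a 0 ^+ 2 + Num.max (- a) 0 ^+ 2.
Proof.
have [a0|/ltW a0] := leP a 0.
  by rewrite max_l ?oppr_ge0 // expr0n add0r sqrrN.
by rewrite max_r ?oppr_le0 // expr0n addr0.
Qed.

Theorem corollary4p5 (R : realType) (I : finType) (E : ptopologicalType)
  (E_polish : polish_space R E)
  (mu : probability (power I (borelType E)) R)
  (mu_ : forall i : I, R.-pker (power (others i) (borelType E)) ~> borelType E)
  (mu_cond : forall i : I, is_cond_distribution mu (mu_ i))
  (dO : measure_display) (Omega : measurableType dO) (P : probability Omega R)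
  (X : {RV P >-> power I (borelType E)})
  (X_law : forall A, measurable A -> distribution P X A = mu A)
  (X' : I -> {RV P >-> borelType E})
  (X'_law : forall i : I, is_resampled_coordinate mu (mu_ i) P X (X' i))
  (rho0 : R) (rho0_gt0 : 0 < rho0)
  (mlsi : modified_log_sobolev mu P X X' rho0) :
  (forall p : R, 1 < p <= 2 ->
     exists2 alpha : R, rho0 / 6 <= alpha & beckner mu P X X' p alpha) /\
  (forall f : power I (borelType E) -> R, measurable_fun setT f ->
   forall r : R, 2 <= r ->
   let K := Num.sqrt (3 * Num.sqrt (expR 1) / (rho0 * (Num.sqrt (expR 1) - 1))) in
   let D i w := f (X w) - f (Xi X X' i w) in
   let integrable_fX := P.-integrable setT (fun w => (f (X w))%:E) in
   let Ef := fine 'E_P[f \o X] in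
   (forall V : I -> Omega -> \bar R,
      (forall i : I, is_cond_expectation P X
         (fun w => (Num.max (D i w) 0 ^+ 2)%:E) (V i)) ->
      let lhs := 'N[P]_r%:E[(fun w => (Num.max (f (X w) - Ef) 0)%:E)]%E in
      let mid := ((K * Num.sqrt r)%:E *
        'N[P]_r%:E[(fun w => sqrte (\sum_(i : I) V i w))])%E in
      let rhs := ((K * Num.sqrt r)%:E *
        'N[P]_r%:E[(fun w => (Num.sqrt (\sum_(i : I) Num.max (D i w) 0 ^+ 2)%R)%:E)])%E in
      estimate integrable_fX lhs mid /\ (mid <= rhs)%E) /\
   (forall V : I -> Omega -> \bar R,
      (forall i : I, is_cond_expectation P X
         (fun w => (D i w ^+ 2)%:E) (V i)) ->
      let lhs := 'N[P]_r%:E[(fun w => (f (X w) - Ef)%:E)]%E in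
      let mid := ((K * Num.sqrt r)%:E *
        'N[P]_r%:E[(fun w => sqrte (\sum_(i : I) V i w))])%E in
      let rhs := ((K * Num.sqrt r)%:E *
        'N[P]_r%:E[(fun w => (Num.sqrt (\sum_(i : I) D i w ^+ 2)%R)%:E)])%E in
      estimate integrable_fX lhs mid /\ (mid <= rhs)%E)).
Proof.
have mX : measurable_fun setT X by [].
have mX' i : measurable_fun setT (X' i) by [].
have exch i := resampling_exchangeable (mu_cond i) (X' := fun i => X' i) mX (mX' i) (X'_law i).
split.
  move=> p p12; exists (rho0 / 6) => //.
  exact: (mlsi_beckner (X' := fun i => X' i) mX mX' rho0_gt0 mlsi p12).
move=> f mf r r2 K D integrable_fX Ef.
have c_def := mlsi_moment_constant rho0_gt0.
have mmax : measurable_fun setT (fun z : R => Num.max z 0) by exact: measurable_maxr.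
have K0 : 0 <= K * Num.sqrt r by rewrite mulr_ge0 // sqrtr_ge0.
split=> V V_cond lhs mid rhs.
- pose T (z : R) := Num.max z 0; pose psi (z : R) := Num.max z 0 ^+ 2.
  have mpsi : measurable_fun setT psi by exact: measurable_funX.
  have psi0 z : 0 <= psi z by exact: sqr_ge0.
  split; last first.
    rewrite lee_wpmul2l ?lee_fin //.
    exact: (cond_mid_le_rhs (X' := fun i => X' i) mX mX' mf r2 mpsi psi0 V_cond).
  apply: (moment_estimate (X' := fun i => X' i) (psi := psi) (T := T) mX mX' X_law exch
    rho0_gt0 mlsi mf r2 mpsi psi0 mmax _ _ _ _ V_cond c_def).
  + by move=> z; rewrite /T le_max lexx orbT.
  + by move=> z; rewrite /T ge_max normr_ge0 ler_norm.
  + move=> a b; have h : Num.max (T a - T b) 0 <= Num.max (a - b) 0.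
      rewrite /T ge_max !le_max lexx !orbT andbT.
      have [a0|a0] := leP a 0; first by rewrite sub0r oppr_le0 le_max lexx !orbT.
      by have [b0|b0] := leP b 0; rewrite ?subr0 ?lexx // lerDl oppr_ge0 b0.
    by rewrite /psi lerXn2r // nnegrE le_max lexx orbT.
  + rewrite ge0_sume_distrr; last first.
      by move=> i _; apply: integral_ge0 => w _; rewrite lee_fin.
    apply: lee_sum => i _.
    pose H (z : power I (borelType E) * power I (borelType E)) := (psi (f z.1 - f z.2))%:E.
    have mH : measurable_fun setT H.
      apply/measurable_EFinP; apply: (measurableT_comp mpsi).
      by apply: measurable_funB; exact: (measurableT_comp mf).
    have H0 z : (0 <= H z)%E by rewrite lee_fin.
    have mXi : measurable_fun setT (Xi X X' i) by exact: measurable_Xi.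
    (* The squared increment is the sum of the squares of its positive and negative parts, which
       exchanging [X] and [X^i] swaps; this is the factor 2 in the comparison of energies. *)
    rewrite (_ : \int[P]_w _ = \int[P]_w (H (X w, Xi X X' i w) + H (Xi X X' i w, X w)))%E; last first.
      apply: eq_integral => w _; rewrite /H /psi /= -EFinD; congr EFin.
      by rewrite [LHS]maxr0_sqr opprB.
    rewrite ge0_integralD //; first last.
    * by apply: (measurableT_comp mH); exact: measurable_fun_pair.
    * by apply: (measurableT_comp mH); exact: measurable_fun_pair.
    by rewrite -(exch i H mH H0) -mule2n -[(_ *+ 2)%E]mule_natl.
- pose T (z : R) := `|z|; pose psi (z : R) := z ^+ 2.
  have mpsi : measurable_fun setT psi by exact: measurable_funX.
  have psi0 z : 0 <= psi z by exact: sqr_ge0.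
  split; last first.
    rewrite lee_wpmul2l ?lee_fin //.
    exact: (cond_mid_le_rhs (X' := fun i => X' i) mX mX' mf r2 mpsi psi0 V_cond).
  (* The norm of the deviation is that of its absolute value, which fits the general estimate with a
     nonnegative [T]. *)
  rewrite /lhs -Lnorm_abse.
  apply: (moment_estimate (X' := fun i => X' i) (psi := psi) (T := T) mX mX' X_law exch
    rho0_gt0 mlsi mf r2 mpsi psi0 _ _ _ _ _ V_cond c_def).
  + exact: normr_measurable.
  + by move=> z; exact: normr_ge0.
  + by [].
  + move=> a b; rewrite /psi /T -[leRHS]real_normK ?num_real //.
    rewrite lerXn2r ?nnegrE ?le_max ?lexx ?orbT // ge_max normr_ge0 andbT.
    exact: lerB_dist.
  + rewrite -[leLHS]mul1e lee_wpmul2r ?lee_fin ?ler1n //.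
    by apply: sume_ge0 => i _; apply: integral_ge0 => w _; rewrite lee_fin sqr_ge0.
Qed.
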